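(* Let $(G,P,\theta)$ be an algebraic dynamical system such that $G$ and $P$ are abelian, $[G:\theta_p(G)]<\infty$ for all $p\in P$, and the canonical representation $\pi\colon\mathcal{Q}(G\rtimes_\theta P)\to\mathcal{L}(\ell^2(G))$ is faithful. Assume moreover that for all $p,q\in P$ with $p\neq q$ there exists $g\in G$ of infinite order such that the group endomorphism $\Phi_{p,q}$ of $G$ given by $\Phi_{p,q}(h)=\theta_p(h)\theta_q(h^{-1})$ is injective on the subgroup $\langle g\rangle\cong\mathbb{Z}$. If $\mathcal{Q}(G\rtimes_\theta P)$ is simple, then ${\rm Aut}_{C^*(G)}\mathcal{Q}(G\rtimes_\theta P)$ is maximal abelian in ${\rm Aut}\,\mathcal{Q}(G\rtimes_\theta P)$.
   Context: An algebraic dynamical system is a triple $(G,P,\theta)$ where $G$ is a countable discrete group; $P$ is a right LCM semigroup, i.e. a countable left cancellative monoid in which the intersection of two principal right ideals is either empty or another principal right ideal; and $\theta$ is an action of $P$ on $G$ by injective group endomorphisms $\theta_p$ which respects the order: $pP\cap qP=rP$ implies $\theta_p(G)\cap\theta_q(G)=\theta_r(G)$. Write $N_p=[G:\theta_p(G)]$. An abelian $P$ is directed with respect to $p\geq q\Leftrightarrow p\in qP$. For directed $P$, the boundary quotient $\mathcal{Q}(G\rtimes_\theta P)$ is the universal $C^*$-algebra generated by a unitary representation $u$ of $G$ and a representation $s$ of the monoid $P$ by isometries satisfying (I) $s_pu_g=u_{\theta_p(g)}s_p$; (II) $s_p^*u_gs_q=u_{g_1}s_{p'}s_{q'}^*u_{g_2}$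 if $g=\theta_p(g_1)\theta_q(g_2)$ and $pP\cap qP=pp'P$, $pp'=qq'$, and $s_p^*u_gs_q=0$ otherwise; (III) $\sum_{[g]\in G/\theta_p(G)}u_gs_ps_p^*u_g^*=1$ whenever $N_p<\infty$. The canonical representation is given by $\pi(u_gs_p)\xi_h=\xi_{g\theta_p(h)}$, where $(\xi_h)_{h\in G}$ is the standard orthonormal basis of $\ell^2(G)$. $C^*(G)$ is identified with the $C^*$-subalgebra of $\mathcal{Q}(G\rtimes_\theta P)$ generated by $\{u_g\mid g\in G\}$. ${\rm Aut}_{C^*(G)}\mathcal{Q}(G\rtimes_\theta P)$ denotes the group of $*$-automorphisms of $\mathcal{Q}(G\rtimes_\theta P)$ that fix $C^*(G)$ pointwise. A subgroup is maximal abelian if it is abelian and not properly contained in another abelian subgroup. *)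

(* Defs.v *)
From HB Require Import structures.
From mathcomp Require Import all_boot all_order all_algebra finmap.
From mathcomp Require Import all_classical all_reals all_analysis.
From mathcomp Require Import showcase.summability.
From mathcomp Require Import complex ring.

Set Implicit Arguments.
Unset Strict Implicit.
Unset Printing Implicit Defensive.

Import Order.TTheory GRing.Theory Num.Theory.
Import numFieldNormedType.Exports.

Local Open Scope classical_set_scope.
Local Open Scope ring_scope.
Local Open Scope complex_scope.

Definition abelian_subgroup (T : groupType) (H : set T) : Prop :=
  group_closed [in H] /\ forall x y, H x -> H y -> commute x y.

Definition maximal_abelian (T : groupType) (H : set T) : Prop :=
  abelian_subgroup H /\ ~ exists K : set T, abelian_subgroup K /\ H `<` K.

Definition infinite_order (G : groupType) (g : G) : Prop :=
  forall n : nat, (0 < n)%N -> (g ^+ n)%g <> 1%g.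

Definition cyclic_subgroup (G : groupType) (g : G) : set G :=
  [set h | exists n : nat, h = (g ^+ n)%g \/ h = (g ^- n)%g].

(* Unital C*-algebras. The norm takes its values in R[i], as in [normedModType
   R[i]]; the axioms force them to be nonnegative, hence real. *)
HB.mixin Record isCStar (R : realType) A of GRing.Algebra R[i] A := {
  star : A -> A;
  starK : involutive star;
  starD : {morph star : x y / x + y};
  starZ : forall (c : R[i]) (x : A), star (c *: x) = c^* *: star x;
  starM : forall x y : A, star (x * y) = star y * star x;
  cnorm : A -> R[i];
  cnormD : forall x y, cnorm (x + y) <= cnorm x + cnorm y;
  cnorm0_eq0 : forall x, cnorm x = 0 -> x = 0;
  cnormZ : forall (c : R[i]) x, cnorm (c *: x) = `|c| * cnorm x;
  cnormM : forall x y, cnorm (x * y) <= cnorm x * cnorm y;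
  cnorm_star : forall x, cnorm (star x * x) = cnorm x ^+ 2;
  cnorm_complete : forall a : nat -> A,
    (forall e : R[i], 0 < e -> exists N : nat, forall m n : nat,
       (N <= m)%N -> (N <= n)%N -> cnorm (a m - a n) < e) ->
    exists l : A, forall e : R[i], 0 < e -> exists N : nat, forall n : nat,
       (N <= n)%N -> cnorm (a n - l) < e
}.

#[short(type="cstarType")]
HB.structure Definition CStar (R : realType) :=
  {A of isCStar R A & GRing.Algebra R[i] A}.

(* The join of [GRing.Algebra] and [NormedModule] cannot be declared as an HB
   structure, hence this instance on the sort of C*-algebras; it makes [`|x|]
   and [closed] refer to [cnorm]. *)
#[non_forgetful_inheritance]
HB.instance Definition _ (R : realType) (A : cstarType R) :=
  Lmodule_isNormed.Build R[i] A (@cnormD R A) (@cnormZ R A) (@cnorm0_eq0 R A).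

Section CStarTheory.
Variables (R : realType).
Implicit Types A B : cstarType R.

Definition star_hom A B (f : A -> B) : Prop :=
  [/\ linear f, {morph f : x y / x * y}, f 1 = 1 & {morph f : x / star x}].

(* C*-subalgebras need not contain the unit of [A]. *)
Definition cstar_subalgebra A (S : set A) : Prop :=
  [/\ submod_closed [in S], forall x y, S x -> S y -> S (x * y),
      forall x, S x -> S (star x) & closed S].

Definition cstar_generated A (X : set A) : set A :=
  smallest (@cstar_subalgebra A) X.

Definition closed_ideal A (I : set A) : Prop :=
  [/\ submod_closed [in I], forall a x, I x -> I (a * x),
      forall a x, I x -> I (x * a) & closed I].

(* [A] is nonzero, as any [algType]. *)
Definition cstar_simple A : Prop :=
  forall I : set A, closed_ideal I -> I = [set 0] \/ I = setT.

Record starAut A := StarAut {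
  aut_fun :> A -> A;
  aut_hom : star_hom aut_fun;
  aut_bij : bijective aut_fun
}.

HB.instance Definition _ A := gen_eqMixin (starAut A).
HB.instance Definition _ A := gen_choiceMixin (starAut A).

Lemma starAut_ext A (f g : starAut A) : aut_fun f =1 aut_fun g -> f = g.
Proof.
case: f g => [f f1 f2] [g g1 g2] /= /funext fg; subst g.
by congr StarAut; exact: Prop_irrelevance.
Qed.

Lemma star_hom_id A : star_hom (@id A).
Proof. by split. Qed.

Lemma star_hom_comp A (f g : A -> A) :
  star_hom f -> star_hom g -> star_hom (f \o g).
Proof.
move=> [fL fM f1 fS] [gL gM g1 gS]; split=> [c x y|x y||x] /=.
- by rewrite gL fL.
- by rewrite gM fM.
- by rewrite g1 f1.
- by rewrite gS fS.
Qed.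

Lemma star_hom_inv A (f g : A -> A) :
  star_hom f -> cancel f g -> cancel g f -> star_hom g.
Proof.
move=> [fL fM f1 fS] fK gK; split=> [c x y|x y||x]; apply: (can_inj fK).
- by rewrite fL !gK.
- by rewrite fM !gK.
- by rewrite f1 !gK.
- by rewrite fS !gK.
Qed.

Definition aut_one A : starAut A :=
  StarAut (@star_hom_id A) (Bijective (fun=> erefl) (fun=> erefl)).

Definition aut_mul A (f g : starAut A) : starAut A :=
  StarAut (star_hom_comp (aut_hom f) (aut_hom g))
          (bij_comp (aut_bij f) (aut_bij g)).

Lemma aut_inv_subproof A (f : starAut A) :
  {g : A -> A | cancel f g /\ cancel g f}.
Proof. by apply: cid; case: (aut_bij f) => g fK gK; exists g. Qed.

Definition aut_inv A (f : starAut A) : starAut A :=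
  let g := aut_inv_subproof f in
  StarAut (star_hom_inv (aut_hom f) (svalP g).1 (svalP g).2)
          (Bijective (svalP g).2 (svalP g).1).

Lemma aut_mulA A : associative (@aut_mul A).
Proof. by move=> f g h; exact: starAut_ext. Qed.
Lemma aut_mul1g A : left_id (aut_one A) (@aut_mul A).
Proof. by move=> f; exact: starAut_ext. Qed.
Lemma aut_mulg1 A : right_id (aut_one A) (@aut_mul A).
Proof. by move=> f; exact: starAut_ext. Qed.
Lemma aut_mulVg A : left_inverse (aut_one A) (@aut_inv A) (@aut_mul A).
Proof.
by move=> f; apply: starAut_ext => x /=; exact: (svalP (aut_inv_subproof f)).1.
Qed.
Lemma aut_mulgV A : right_inverse (aut_one A) (@aut_inv A) (@aut_mul A).
Proof.
by move=> f; apply: starAut_ext => x /=; exact: (svalP (aut_inv_subproof f)).2.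
Qed.

HB.instance Definition _ A := isGroup.Build (starAut A)
  (@aut_mulA A) (@aut_mul1g A) (@aut_mulg1 A) (@aut_mulVg A) (@aut_mulgV A).

Definition fixing_aut A (S : set A) : set (starAut A) :=
  [set f | forall x, S x -> f x = x].

End CStarTheory.

Section L2.
Variables (R : realType) (G : choiceType).

Definition sqnorm (f : G -> R[i]^o) : \bar R :=
  (\esum_(g in [set: G]) (Normc.normc (f g) ^+ 2)%:E)%E.

Definition l2_pred : {pred G -> R[i]^o} := fun f => `[< (sqnorm f < +oo)%E >].

Lemma normc_ge0 (z : R[i]) : 0 <= Normc.normc z.
Proof. by case: z => a b; exact: sqrtr_ge0. Qed.

Let nn (h : G -> R[i]^o) x : (0 <= (Normc.normc (h x) ^+ 2)%:E)%E.
Proof. by rewrite lee_fin sqr_ge0. Qed.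

Lemma sqnormD (f g : G -> R[i]^o) :
  (sqnorm (f + g)%R <= (sqnorm f + sqnorm f) + (sqnorm g + sqnorm g))%E.
Proof.
rewrite -!esumD; do ?[by move=> *; rewrite ?adde_ge0 ?nn].
apply: le_esum => x _; rewrite -!EFinD lee_fin.
have h := le_normcD (f x) (g x).
apply: le_trans (ler_pM (normc_ge0 _) (normc_ge0 _) h h) _.
rewrite -subr_ge0; set a := Normc.normc _; set b := Normc.normc _.
by have -> : a ^+ 2 + a ^+ 2 + (b ^+ 2 + b ^+ 2) - (a + b) * (a + b)
  = (a - b) ^+ 2 by [ring]; exact: sqr_ge0.
Qed.

Lemma sqnormZ (c : R[i]) (f : G -> R[i]^o) :
  exists n : nat, (sqnorm (c *: f)%R <= \sum_(j < n) sqnorm f)%E.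
Proof.
exists (Num.truncn (Normc.normc c ^+ 2)).+1.
rewrite -esum_sum; last by move=> x j _ _; exact: nn.
apply: le_esum => x _; rewrite sumEFin lee_fin sumr_const card_ord.
rewrite -mulr_natl [Normc.normc _](Normc.normcM c (f x)) exprMn.
by rewrite ler_wpM2r ?sqr_ge0// ltW// truncnS_gt.
Qed.

Lemma l2_closed : subsemimod_closed l2_pred.
Proof.
split; first split.
- apply/asboolP; rewrite /sqnorm esum1 ?ltry// => x _.
  by rewrite Normc.normc0 expr0n.
- move=> f g /asboolP fl /asboolP gl; apply/asboolP.
  by apply: le_lt_trans (sqnormD f g) _; rewrite !lte_add_pinfty.
- move=> c f /asboolP fl; apply/asboolP.
  have [n /le_lt_trans] := sqnormZ c f; apply.
  by apply: lte_sum_pinfty.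
Qed.

HB.instance Definition _ :=
  GRing.isSubmodClosed.Build R[i] (G -> R[i]^o) l2_pred l2_closed.

Record l2 := L2 { l2_fun :> G -> R[i]^o; l2_funP : l2_fun \in l2_pred }.

HB.instance Definition _ := [isSub for l2_fun].
HB.instance Definition _ := [Choice of l2 by <:].
HB.instance Definition _ := [SubChoice_isSubLmodule of l2 by <:].

Lemma delta_l2 (h : G) : (fun g => (g == h)%:R : R[i]^o) \in l2_pred.
Proof.
apply/asboolP; rewrite /sqnorm.
rewrite (@eq_esum _ _ _ _ (fun g => if g \in [set h] then 1 else 0)%E).
  by rewrite -esum_mkcond esum_set1// ltry.
move=> g _; rewrite in_set1; case: eqP => _.
  by rewrite mulr1n Normc.normc1 expr1n.
by rewrite mulr0n Normc.normc0 expr0n.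
Qed.

Definition xi (h : G) : l2 := L2 (delta_l2 h).

Definition l2norm (f : l2) : R := Num.sqrt (fine (sqnorm f)).

(* [summability.sum] is the limit of the partial sums along the finite subsets
   of [G]. *)
Definition l2dot (f g : l2) : R[i]^o :=
  summability.sum (fun h => (f h * (g h)^* : R[i]^o)).

Definition bounded_op (T : l2 -> l2) : Prop :=
  linear T /\ exists M : R, forall f, l2norm (T f) <= M * l2norm f.

End L2.

Section ADS.
Variables (G : groupType) (P : monoidType).

Definition right_ideal (p : P) : set P := range (fun q => (p * q)%g).

Record right_LCM : Prop := RightLCM {
  rlcm_countable : countable [set: P];
  rlcm_cancel : forall p q r : P, (p * q = p * r)%g -> q = r;
  rlcm_meet : forall p q : P,
    right_ideal p `&` right_ideal q = set0 \/
    exists r, right_ideal p `&` right_ideal q = right_ideal r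
}.

Variable theta : P -> G -> G.

Record ads : Prop := Ads {
  ads_countable : countable [set: G];
  ads_rlcm : right_LCM;
  ads_morph : forall p, {morph theta p : g h / (g * h)%g};
  ads_inj : forall p, injective (theta p);
  ads_act1 : forall g, theta 1%g g = g;
  ads_actM : forall p q g, theta (p * q)%g g = theta p (theta q g);
  ads_order : forall p q r,
    right_ideal p `&` right_ideal q = right_ideal r ->
    range (theta p) `&` range (theta q) = range (theta r)
}.

Definition left_cosets (p : P) : set (set G) :=
  [set [set (g * theta p h)%g | h in [set: G]] | g in [set: G]].

Definition finite_index (p : P) : Prop := finite_set (left_cosets p).

Definition coset_transversal (p : P) (t : seq G) : Prop :=
  uniq t /\ forall X, left_cosets p X -> exists! g, g \in t /\ X g.

Variable R : realType.

Definition unitary_rep (A : cstarType R) (u : G -> A) : Prop :=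
  [/\ u 1%g = 1, forall g h, u (g * h)%g = u g * u h,
      forall g, star (u g) * u g = 1 & forall g, u g * star (u g) = 1].

Definition isometric_rep (A : cstarType R) (s : P -> A) : Prop :=
  [/\ s 1%g = 1, forall p q, s (p * q)%g = s p * s q &
      forall p, star (s p) * s p = 1].

Definition factors (p q : P) (g g1 g2 : G) (p' q' : P) : Prop :=
  [/\ g = (theta p g1 * theta q g2)%g,
      right_ideal p `&` right_ideal q = right_ideal (p * p')%g &
      (p * p')%g = (q * q')%g].

(* In [bq_sum] the summand depends only on the left coset of [g], by
   [bq_covariant], so that summing over G / theta_p(G) amounts to summing over
   any transversal. *)
Record bq_family (A : cstarType R) (u : G -> A) (s : P -> A) : Prop := BQFamily {
  bq_unitary : unitary_rep u;
  bq_isometry : isometric_rep s;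
  bq_covariant : forall p g, s p * u g = u (theta p g) * s p;
  bq_product : forall p q g g1 g2 p' q', factors p q g g1 g2 p' q' ->
    star (s p) * u g * s q = u g1 * s p' * star (s q') * u g2;
  bq_product0 : forall p q g, ~ (exists g1 g2 p' q', factors p q g g1 g2 p' q') ->
    star (s p) * u g * s q = 0;
  bq_sum : forall p, finite_index p -> forall t, coset_transversal p t ->
    \sum_(g <- t) u g * s p * star (s p) * star (u g) = 1
}.

(* The homomorphism in [bq_univ] is unique by [bq_gen], *-homomorphisms between
   C*-algebras being continuous. *)
Record boundary_quotient (Q : cstarType R) (u : G -> Q) (s : P -> Q) : Prop :=
  BoundaryQuotient {
  bq_rel : bq_family u s;
  bq_gen : cstar_generated (range u `|` range s) = [set: Q];
  bq_univ : forall (B : cstarType R) (v : G -> B) (t : P -> B),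
    bq_family v t ->
    exists f : Q -> B,
      [/\ star_hom f, forall g, f (u g) = v g & forall p, f (s p) = t p]
}.

Record l2_representation (A : cstarType R) (pi : A -> l2 R G -> l2 R G) : Prop :=
  L2Representation {
  rep_bounded : forall a, bounded_op (pi a);
  rep_linear : forall c a b f, pi (c *: a + b) f = c *: pi a f + pi b f;
  rep_mul : forall a b f, pi (a * b) f = pi a (pi b f);
  rep_one : forall f, pi 1 f = f;
  rep_star : forall a f g, l2dot (pi (star a) f) g = l2dot f (pi a g)
}.

Definition canonical_rep (Q : cstarType R) (u : G -> Q) (s : P -> Q)
    (pi : Q -> l2 R G -> l2 R G) : Prop :=
  l2_representation pi /\
  forall g p h, pi (u g * s p) (xi R h) = xi R (g * theta p h)%g.

Definition Phi (p q : P) (h : G) : G := (theta p h * theta q h^-1)%g.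

End ADS.

(* Main.v *)
Require Import Defs.
From HB Require Import structures.
From mathcomp Require Import all_boot all_order all_algebra finmap.
From mathcomp Require Import all_classical all_reals all_analysis.
From mathcomp Require Import showcase.summability.
From mathcomp Require Import complex ring lra.

Set Implicit Arguments.
Unset Strict Implicit.
Unset Printing Implicit Defensive.

Import Order.TTheory GRing.Theory Num.Theory.
Import numFieldNormedType.Exports.

Local Open Scope classical_set_scope.
Local Open Scope ring_scope.
Local Open Scope complex_scope.

(** The group [H] of automorphisms fixing the [u_g] is abelian and is its own
    centralizer; both facts follow from a rigidity property of the relative
    commutant [C] of the [u_g]: every [psi] in [H] fixes [C] pointwise.

    Rigidity ([relative_commutant_fixed]).  Write [T x = x - psi x] and average
    over conjugations by the [u_g]: elements of [C], and hence [T d] for [d] in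
    [C], do not move, while [T] commutes with averaging.  The combinations of
    the monomials [u_g s_p s_q^* u_h] are dense, so it is enough that averaging
    kills [T m] for a monomial [m].  If [p = q], averaging over
    [G / theta_p(G)] gives a multiple of [u_(gh)] by relation (III), and [T]
    vanishes there.  If [p <> q], conjugation by [u_(theta_q(k))] multiplies
    [m] and [psi m] by [u_(Phi_(q,p)(k))]; when [k] runs through the powers of
    the element supplied by the hypothesis on [Phi_(q,p)], these are distinct
    translations of [l^2(G)], whose averages tend to zero in every matrix
    coefficient by Cauchy--Schwarz.  As the representation is injective,
    [T d = 0].

    [H] is abelian.  A unitary [z] in [C] gives an inner automorphism in [H],
    which fixes [C] by rigidity; so [C] is commutative.  By (III) and the
    finiteness of the indices, [phi(s_p)] is the sum over a transversal of
    [u_k s_p d_k] with [d_k = s_p^* u_k^* phi(s_p)] in [C], and two such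
    expansions commute because elements of [H] do not move the [d_k].

    [H] is its own centralizer.  If [phi] commutes with [H], it commutes with
    conjugation by every unitary [z] in [C], so [z^* phi(z)] is central, hence
    scalar since the algebra is simple: [phi(z) = l z].  In particular
    [phi(u_g) = chi u_g].  Comparing Fourier coefficients in the same identity
    for [z = (1 + c u_g)(1 + c u_g)^*^-1] with [c = i/2], a unitary with several
    nonzero coefficients, gives [chi = 1].

    The C*-algebra theory used here comes from one device: for [|x| <= 1] an
    iteration gives a square root of [1 - x] ([sqrt_exists]).  It writes every
    element as a combination of four unitaries ([unitary_decomp]), which bounds
    *-homomorphisms and the matrix coefficients of representations by twice the
    norm, and it shows without spectral theory that the center of a simple
    algebra is scalar ([simple_center]). *)

(** * The real-valued norm *)

Section RealNorm.
Variables (R : realType) (A : cstarType R).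
Implicit Types (x y z : A) (S : set A).

(** [cnorm] takes its values in [R[i]]; this real version can be handled by the
    order of [R]. *)
Definition nrm x : R := complex.Re (cnorm x).

Lemma cnormE x : cnorm x = (nrm x)%:C.
Proof.
have h : 0 <= cnorm x by have := normr_ge0 x.
by rewrite /nrm RRe_real// ger0_real.
Qed.

Lemma nrm_ge0 x : 0 <= nrm x.
Proof.
have h : 0 <= cnorm x by have := normr_ge0 x.
by rewrite -ler0c -cnormE.
Qed.

Lemma nrm0_eq0 x : nrm x = 0 -> x = 0.
Proof. by move=> h; apply: cnorm0_eq0; rewrite cnormE h. Qed.

Lemma nrmD x y : nrm (x + y) <= nrm x + nrm y.
Proof. by rewrite -lecR rmorphD /= -!cnormE cnormD. Qed.

Lemma nrmM x y : nrm (x * y) <= nrm x * nrm y.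
Proof. by rewrite -lecR rmorphM /= -!cnormE cnormM. Qed.

Lemma nrmZ (c : R[i]) x : nrm (c *: x) = Normc.normc c * nrm x.
Proof.
by apply: complexI; rewrite rmorphM /= -!cnormE cnormZ normc_def; case: c.
Qed.

Lemma nrm_starM x : nrm (star x * x) = nrm x ^+ 2.
Proof. by apply: complexI; rewrite rmorphXn /= -!cnormE cnorm_star. Qed.

Lemma nrmN x : nrm (- x) = nrm x.
Proof. by rewrite -scaleN1r nrmZ normcN Normc.normc1 mul1r. Qed.

Lemma nrm0 : nrm 0 = 0.
Proof. by rewrite -(scale0r 0) nrmZ Normc.normc0 mul0r. Qed.

Lemma nrmB x y : nrm (x - y) <= nrm x + nrm y.
Proof. by rewrite -[nrm y]nrmN nrmD. Qed.

Lemma nrmBC x y : nrm (x - y) = nrm (y - x).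
Proof. by rewrite -nrmN opprB. Qed.

Lemma nrm_gt0 x : x != 0 -> 0 < nrm x.
Proof.
by move=> x0; rewrite lt_def nrm_ge0 andbT; apply: contra_neq x0; exact: nrm0_eq0.
Qed.

Lemma nrm_star x : nrm (star x) = nrm x.
Proof.
suff H y : nrm y <= nrm (star y).
  by apply/le_anti; rewrite H -{2}(starK x) H.
have [->|y0] := eqVneq y 0; first by rewrite nrm0 nrm_ge0.
have := nrmM (star y) y; rewrite nrm_starM expr2.
by rewrite ler_pM2r// nrm_gt0.
Qed.

Lemma nrm_eq0P x : (forall e : R, 0 < e -> nrm x <= e) -> x = 0.
Proof.
move=> h; apply: nrm0_eq0; apply/le_anti; rewrite nrm_ge0 andbT.
by apply/ler_addgt0Pr => e e0; rewrite add0r h.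
Qed.

Lemma star1 : star 1 = 1 :> A.
Proof. by have := starM (star 1) (1 : A); rewrite mulr1 starK mulr1. Qed.

Lemma star0 : star 0 = 0 :> A.
Proof. by rewrite -(scale0r (0 : A)) starZ rmorph0 !scale0r. Qed.

Lemma starN x : star (- x) = - star x.
Proof. by rewrite -scaleN1r starZ rmorphN1 scaleN1r. Qed.

Lemma starB x y : star (x - y) = star x - star y.
Proof. by rewrite starD starN. Qed.

Lemma nrm1 : nrm 1 = 1.
Proof.
have := nrm_starM 1; rewrite star1 mulr1 => h.
have n0 : nrm 1 != 0.
  by apply/eqP => /nrm0_eq0 /eqP; rewrite oner_eq0.
by apply: (mulIf n0); rewrite mul1r -expr2.
Qed.

Lemma nrm_unitary z : star z * z = 1 -> nrm z = 1.
Proof.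
move=> h; have := nrm_starM z; rewrite h nrm1 => /esym/eqP.
by rewrite sqrp_eq1 ?nrm_ge0// => /eqP.
Qed.

Definition cvgto (a : nat -> A) l := forall e : R, 0 < e ->
  exists N : nat, forall n, (N <= n)%N -> nrm (a n - l) < e.

Lemma nrm_complete (a : nat -> A) :
  (forall e : R, 0 < e -> exists N : nat, forall m n : nat,
       (N <= m)%N -> (m <= n)%N -> nrm (a n - a m) < e) ->
  exists l, cvgto a l.
Proof.
move=> h; have [|l hl] := @cnorm_complete R A a.
  move=> e e0; have e0' : 0 < complex.Re e by move: e0; rewrite ltcE /= => /andP[].
  have [N HN] := h _ e0'; exists N => m n Nm Nn.
  have -> : e = (complex.Re e)%:C by rewrite RRe_real// gtr0_real.
  rewrite cnormE ltcR; case: (leqP m n) => mn; last exact: HN (ltnW mn).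
  by rewrite nrmBC HN.
exists l => e e0; have [|N HN] := hl e%:C; first by rewrite ltcR.
by exists N => n Nn; rewrite -ltcR -cnormE HN.
Qed.

Definition norm_closure S x := forall e : R, 0 < e -> exists y, S y /\ nrm (x - y) < e.

Lemma closedP S : closed S
  <-> (forall x, norm_closure S x -> S x).
Proof.
split=> [cS x ax|h x cx].
  apply: cS => B /nbhs_ballP[e /= e0 eB].
  have e0' : 0 < complex.Re e by move: e0; rewrite ltcE /= => /andP[].
  have [y [Sy xy]] := ax _ e0'; exists y; split => //; apply: eB.
  rewrite -ball_normE /=.
  have -> : e = (complex.Re e)%:C by rewrite RRe_real// gtr0_real.
  by move: xy; rewrite -ltcR -cnormE.
apply: h => e e0.
have e0' : 0 < e%:C by rewrite ltcR.
have [y [Sy]] := cx _ (nbhsx_ballx x _ e0').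
by rewrite -ball_normE /= => xy; exists y; split => //; rewrite -ltcR -cnormE.
Qed.

End RealNorm.

(** * Limits, Neumann series and square roots *)

Lemma nondecreasing_cauchy (R : realType) (om : nat -> R) M :
  (forall n, om n <= om n.+1) -> (forall n, om n <= M) ->
  forall e, 0 < e -> exists N, forall m n,
    (N <= m)%N -> (m <= n)%N -> om n - om m < e.
Proof.
move=> om_inc omM e e0.
have omh : {homo om : m n / (m <= n)%N >-> m <= n}.
  exact: (homo_leq (@lexx _ _) le_trans).
have hs : has_sup (range om).
  by split; [exists (om 0%N); exists 0%N | exists M => _ [n _ <-]].
have [_ [N _ <-] hN] := sup_adherent e0 hs.
exists N => m n Nm _.
have : om n <= sup (range om).
  by apply: sup_ubound; [case: hs|exists n].
by move=> h; have := omh _ _ Nm; lra.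
Qed.

Section Limits.
Variables (R : realType) (A : cstarType R).
Implicit Types (x y z b : A).

Lemma cvgto_uniq (a : nat -> A) x y : cvgto a x -> cvgto a y -> x = y.
Proof.
move=> ax ay; apply/eqP; rewrite -subr_eq0; apply/eqP/nrm_eq0P => e e0.
have [N hN] := ax _ (divr_gt0 e0 (ltr0Sn R 1)).
have [K hK] := ay _ (divr_gt0 e0 (ltr0Sn R 1)).
have {}hN := hN _ (leq_maxl N K); have {}hK := hK _ (leq_maxr N K).
have -> : x - y = (a (maxn N K) - y) - (a (maxn N K) - x).
  by rewrite opprB [RHS]addrC addrA subrK.
by apply: le_trans (nrmB _ _) _; lra.
Qed.

Lemma cvgto_cst x : cvgto (fun=> x) x.
Proof. by move=> e e0; exists 0%N => n _; rewrite subrr nrm0. Qed.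

Lemma cvgto_shift (a : nat -> A) x : cvgto a x -> cvgto (fun n => a n.+1) x.
Proof. by move=> h e /h[N hN]; exists N => n Nn; apply: hN; exact: leqW. Qed.

Lemma cvgtoD (a b : nat -> A) x y :
  cvgto a x -> cvgto b y -> cvgto (fun n => a n + b n) (x + y).
Proof.
move=> ax ay e e0.
have [N hN] := ax _ (divr_gt0 e0 (ltr0Sn R 1)).
have [K hK] := ay _ (divr_gt0 e0 (ltr0Sn R 1)).
exists (maxn N K) => n; rewrite geq_max => /andP[/hN {}hN /hK {}hK].
by rewrite opprD addrACA; apply: le_lt_trans (nrmD _ _) _; lra.
Qed.

Lemma cvgtoM (a b : nat -> A) x y :
  cvgto a x -> cvgto b y -> cvgto (fun n => a n * b n) (x * y).
Proof.
move=> ax ay e e0.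
have x0 := nrm_ge0 x; have y0 := nrm_ge0 y.
set d := e / (nrm x + nrm y + 2%:R).
have d0 : 0 < d by apply: divr_gt0 => //; lra.
have [N hN] := ax _ d0; have [K hK] := ay _ d0; have [J hJ] := ay _ ltr01.
exists (maxn (maxn N K) J) => n.
rewrite !geq_max => /andP[/andP[/hN {}hN /hK {}hK] /hJ {}hJ].
have -> : a n * b n - x * y = (a n - x) * b n + x * (b n - y).
  by rewrite mulrBl mulrBr addrA subrK.
have bn : nrm (b n) <= nrm y + 1.
  rewrite -[b n](subrK y); apply: le_trans (nrmD _ _) _; lra.
apply: le_lt_trans (nrmD _ _) _.
have h1 : nrm ((a n - x) * b n) <= d * (nrm y + 1).
  apply: le_trans (nrmM _ _) _.
  by apply: ler_pM; rewrite ?nrm_ge0//; exact: ltW.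
have h2 : nrm (x * (b n - y)) <= nrm x * d.
  apply: le_trans (nrmM _ _) _.
  by apply: ler_pM; rewrite ?nrm_ge0//; exact: ltW.
have : d * (nrm x + nrm y + 2%:R) = e by rewrite /d divfK//; lra.
by move=> h; lra.
Qed.

Lemma cvgtoZ (c : R[i]) (a : nat -> A) x :
  cvgto a x -> cvgto (fun n => c *: a n) (c *: x).
Proof.
move=> ax; have h := cvgtoM (cvgto_cst (c *: 1)) ax.
move=> e /h[N hN]; exists N => n /hN.
by rewrite -!scalerAl !mul1r.
Qed.

Lemma cvgto_star (a : nat -> A) x :
  cvgto a x -> cvgto (fun n => star (a n)) (star x).
Proof.
by move=> h e /h[N hN]; exists N => n /hN; rewrite -starB nrm_star.
Qed.

Lemma cvgto_comm (a : nat -> A) x b :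
  (forall n, GRing.comm b (a n)) -> cvgto a x -> GRing.comm b x.
Proof.
move=> h ax; apply: (cvgto_uniq (cvgtoM (cvgto_cst b) ax)).
have := cvgtoM ax (cvgto_cst b).
by under eq_fun do rewrite -h.
Qed.

Lemma commZ (c : R[i]) x y : GRing.comm x y -> GRing.comm x (c *: y).
Proof. by rewrite /GRing.comm -scalerAl -scalerAr => ->. Qed.

(** Both iterations below, for inverses and for square roots, are compared with
    the same iteration run on numbers. *)
Lemma dominated_cvgto (w : nat -> A) (om : nat -> R) M :
  (forall n, nrm (w n.+1 - w n) <= om n.+1 - om n) -> (forall n, om n <= M) ->
  exists l, cvgto w l.
Proof.
move=> h omM.
have om_inc n : om n <= om n.+1.
  by rewrite -subr_ge0; exact: le_trans (nrm_ge0 _) (h n).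
apply: nrm_complete => e /(nondecreasing_cauchy om_inc omM)[N hN].
exists N => m n Nm mn; apply: le_lt_trans (hN _ _ Nm mn).
elim: n mn => [|n IH]; first by rewrite leqn0 => /eqP ->; rewrite subrr nrm0 subrr.
rewrite leq_eqVlt => /predU1P[->|]; first by rewrite !subrr nrm0.
rewrite ltnS => /IH {}IH.
have -> : w n.+1 - w m = (w n.+1 - w n) + (w n - w m) by rewrite addrA subrK.
by apply: le_trans (nrmD _ _) _; have := h n; lra.
Qed.

(** Neumann series, as the limit of the iteration [w' = 1 + a w]. *)
Lemma neumann a : nrm a < 1 ->
  exists v, [/\ (1 - a) * v = 1, v * (1 - a) = 1 &
    forall b, GRing.comm b a -> GRing.comm b v].
Proof.
move=> a1; have a0 := nrm_ge0 a.
pose w := fix w n := if n is m.+1 then 1 + a * w m else 0.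
pose om := fix om n : R := if n is m.+1 then 1 + nrm a * om m else 0.
have omM n : om n <= (1 - nrm a)^-1.
  elim: n => [|n IH] /=; first by rewrite invr_ge0; lra.
  have h : 1 + nrm a * (1 - nrm a)^-1 = (1 - nrm a)^-1 by field; lra.
  by rewrite -h lerD2l ler_wpM2l.
have [n|l wl] := dominated_cvgto _ omM (w := w).
  elim: n => [|n IH] /=; first by rewrite mulr0 !subr0 mulr0 !addr0 nrm1.
  have -> : 1 + a * (1 + a * w n) - (1 + a * w n) = a * (w n.+1 - w n).
    by rewrite [RHS]mulrBr opprD addrACA subrr add0r.
  have -> : 1 + nrm a * (1 + nrm a * om n) - (1 + nrm a * om n)
    = nrm a * (om n.+1 - om n) by rewrite /=; ring.
  apply: le_trans (nrmM _ _) _; exact: ler_wpM2l.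
have lE : l = 1 + a * l.
  apply: (cvgto_uniq (cvgto_shift wl)).
  exact: cvgtoD (cvgto_cst _) (cvgtoM (cvgto_cst _) wl).
have lC b : GRing.comm b a -> GRing.comm b l.
  move=> ba; apply: cvgto_comm wl; elim=> [|n IH] /=; first exact: commr0.
  by apply: commrD; [exact: commr1|exact: commrM].
have h : (1 - a) * l = 1 by rewrite mulrBl mul1r {1}lE addrK.
exists l; split => //; rewrite -[LHS]lC ?h//.
by apply: commr_sym; apply: commrB; [exact: commr1|].
Qed.

End Limits.

Section Sqrt.
Variables (R : realType) (A : cstarType R).
Implicit Types (x y z b : A).

Definition onehalf : R[i] := (2^-1)%:C.

Lemma onehalf_split x : onehalf *: (x + x) = x.
Proof.
rewrite scalerDr -scalerDl /onehalf -rmorphD /=.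
by have -> : 2^-1 + 2^-1 = 1 :> R by [field]; rewrite scale1r.
Qed.

Lemma conj_onehalf : Num.conj onehalf = onehalf.
Proof. exact: conjc_real. Qed.

Lemma normc_real (r : R) : Normc.normc r%:C = `|r|.
Proof. by rewrite /= expr0n addr0 sqrtr_sqr. Qed.

Lemma normc_onehalf : Normc.normc onehalf = 2^-1.
Proof. by rewrite normc_real ger0_norm// invr_ge0. Qed.

(** The iteration [w' = (x + w^2)/2] for [1 - sqrt(1 - x)] has nonnegative
    coefficients, hence it is dominated by the same iteration at the number 1,
    whose values stay below 1. *)
Lemma sqrt_exists x : nrm x <= 1 ->
  exists y, [/\ y * y = 1 - x, star x = x -> star y = y &
    forall b, GRing.comm b x -> GRing.comm b y].
Proof.
move=> x1.
pose w := fix w n := if n is m.+1 then onehalf *: (x + w m * w m) else 0.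
pose om := fix om n : R := if n is m.+1 then (1 + om m * om m) / 2 else 0.
have om01 n : 0 <= om n <= 1.
  elim: n => [|n IH] /=; first lra.
  by nra.
have wx n : nrm (w n) <= om n.
  elim: n => [|n IH] /=; first by rewrite nrm0.
  rewrite nrmZ normc_onehalf mulrC ler_pM2r ?invr_gt0//.
  apply: le_trans (nrmD _ _) _; apply: lerD => //.
  by apply: le_trans (nrmM _ _) _; apply: ler_pM; rewrite ?nrm_ge0.
have wC b n : GRing.comm b x -> GRing.comm b (w n).
  move=> bx; elim: n => [|n IH] /=; first exact: commr0.
  by apply: commZ; apply: commrD => //; exact: commrM.
have wwC n m : GRing.comm (w n) (w m).
  by apply: (wC); apply: commr_sym; exact: wC.
have [n|l wl] := dominated_cvgto _ (fun n => proj2 (andP (om01 n))) (w := w).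
  elim: n => [|n IH].
    by rewrite /= !mulr0 !addr0 !subr0 nrmZ normc_onehalf mulrC ler_wpM2r.
  have -> : w n.+2 - w n.+1 = onehalf *: ((w n.+1 - w n) * (w n.+1 + w n)).
    have stepw k : w k.+1 = onehalf *: (x + w k * w k) by [].
    rewrite [w n.+2]stepw [X in _ - X]stepw -scalerBr opprD addrACA subrr add0r.
    by rewrite mulrBl !mulrDr (wwC n n.+1) opprD addrA addrK.
  have -> : om n.+2 - om n.+1 = 2^-1 * ((om n.+1 - om n) * (om n.+1 + om n)).
    have stepom k : om k.+1 = (1 + om k * om k) / 2 by [].
    by rewrite [om n.+2]stepom [X in _ - X]stepom; field.
  rewrite nrmZ normc_onehalf.
  rewrite ler_pM2l ?invr_gt0//; apply: le_trans (nrmM _ _) _.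
  apply: ler_pM; rewrite ?nrm_ge0//.
  by apply: le_trans (nrmD _ _) _; apply: lerD.
have lE : l = onehalf *: (x + l * l).
  apply: (cvgto_uniq (cvgto_shift wl)); apply: cvgtoZ.
  exact: cvgtoD (cvgto_cst _) (cvgtoM wl wl).
exists (1 - l); split.
- have : l + l = x + l * l by rewrite {1 2}lE -scalerDr onehalf_split.
  move=> h; rewrite mulrBl mul1r mulrBr mulr1 opprB addrA -addrA.
  rewrite [l * l - l]addrC addrA -[1 - l - l]addrA -opprD h.
  by rewrite opprD addrA subrK.
- move=> xs; rewrite starB star1; congr (_ - _).
  apply: (cvgto_uniq (cvgto_star wl)).
  have -> : (fun n => star (w n)) = w; last by [].
  apply/funext; elim=> [|n IH] /=; first exact: star0.
  by rewrite starZ starD starM IH xs conj_onehalf.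
- move=> b bx; apply: commrB; first exact: commr1.
  by apply: cvgto_comm wl => n; exact: wC.
Qed.

End Sqrt.

(** * Unitaries *)

Section Unitaries.
Variables (R : realType) (A : cstarType R).
Implicit Types (x y z b : A).

Definition unitary z := star z * z = 1 /\ z * star z = 1.

Lemma unitary1 : unitary (1 : A).
Proof. by split; rewrite star1 mul1r. Qed.

Lemma unitary_star z : unitary z -> unitary (star z).
Proof. by case=> z1 z2; split; rewrite starK. Qed.

Lemma conj_i : Num.conj ('i : R[i]) = - 'i.
Proof. by apply/eqP; rewrite eq_complex /= oppr0 !eqxx. Qed.

Lemma mulii : 'i * 'i = -1 :> R[i].
Proof. exact: sqr_i. Qed.

Lemma normc_i : Normc.normc ('i : R[i]) = 1.
Proof. by rewrite /= expr0n add0r expr1n sqrtr1. Qed.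

Lemma star_cartesian x y : star x = x -> star y = y ->
  star (x + 'i *: y) = x - 'i *: y.
Proof. by move=> xs ys; rewrite starD starZ xs ys conj_i scaleNr. Qed.

Lemma cartesianM x y : GRing.comm x y ->
  (x - 'i *: y) * (x + 'i *: y) = x * x + y * y.
Proof.
move=> xy; rewrite mulrBl !mulrDr -!scalerAl -!scalerAr scalerA mulii scaleN1r.
by rewrite xy opprD opprK addrA addrK.
Qed.

Lemma cartesian_re x y : onehalf R *: ((x + 'i *: y) + (x - 'i *: y)) = x.
Proof. by rewrite addrACA subrr addr0 onehalf_split. Qed.

(** A self-adjoint contraction [a] is the real part of [a + i sqrt(1 - a^2)]. *)
Lemma unitary_re a : star a = a -> nrm a <= 1 ->
  exists z, [/\ unitary z, a = onehalf R *: (z + star z) &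
    forall b, GRing.comm b a -> GRing.comm b z].
Proof.
move=> sa a1.
have [|y [yy ys yC]] := @sqrt_exists R A (a * a).
  by rewrite -{1}sa nrm_starM expr_le1// nrm_ge0.
have {}ys : star y = y by apply: ys; rewrite starM sa.
have ay : GRing.comm a y by apply: yC; apply: commrM.
exists (a + 'i *: y); split.
- split; rewrite star_cartesian//; first by rewrite cartesianM// yy addrC subrK.
  have := @cartesianM a (- y) (commrN ay).
  by rewrite scalerN opprK mulrNN yy [RHS]addrC subrK => ->.
- by rewrite star_cartesian// cartesian_re.
- move=> b ba; apply: commrD => //; apply: commZ; apply: yC; exact: commrM.
Qed.

Definition re x := onehalf R *: (x + star x).
Definition im x := onehalf R *: (- 'i *: (x - star x)).

Lemma re_sa x : star (re x) = re x.
Proof. by rewrite starZ starD starK conj_onehalf addrC. Qed.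

Lemma im_sa x : star (im x) = im x.
Proof.
rewrite /im !starZ starB starK conj_onehalf rmorphN /= conj_i opprK.
by rewrite -[star x - x]opprB scalerN scaleNr.
Qed.

Lemma re_im x : x = re x + 'i *: im x.
Proof.
rewrite /im !scalerA mulrAC mulrN mulii opprK mul1r.
by rewrite -scalerDr addrACA subrr addr0 onehalf_split.
Qed.

Lemma nrm_re x : nrm (re x) <= nrm x.
Proof.
rewrite nrmZ normc_onehalf; have := nrmD x (star x); rewrite nrm_star; lra.
Qed.

Lemma nrm_im x : nrm (im x) <= nrm x.
Proof.
rewrite !nrmZ normc_onehalf normcN normc_i mul1r.
have := nrmB x (star x); rewrite nrm_star; lra.
Qed.

Lemma comm_re b x : GRing.comm b x -> GRing.comm b (star x) -> GRing.comm b (re x).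
Proof. by move=> bx bs; apply: commZ; exact: commrD. Qed.

Lemma comm_im b x : GRing.comm b x -> GRing.comm b (star x) -> GRing.comm b (im x).
Proof. by move=> bx bs; do 2!apply: commZ; exact: commrB. Qed.

Lemma normalize x : x != 0 ->
  exists x', [/\ nrm x' = 1, x = (nrm x)%:C *: x', star x = x -> star x' = x' &
    forall b, GRing.comm b x -> GRing.comm b x'].
Proof.
move=> x0; have n0 := nrm_gt0 x0; exists ((nrm x)^-1%:C *: x); split.
- by rewrite nrmZ normc_real ger0_norm ?invr_ge0 ?nrm_ge0// mulVf// gt_eqF.
- by rewrite scalerA -rmorphM /= mulfV ?gt_eqF// scale1r.
- by move=> sx; rewrite starZ sx; congr (_ *: _); exact: conjc_real.
- by move=> b; exact: commZ.
Qed.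

(** The last clause places the unitaries in the bicommutant of [x] and [x^*];
    it makes them commute with the [u_g] whenever [x] does. *)
Lemma unitary_decomp x : exists z1 z2, [/\ unitary z1, unitary z2,
   x = ((nrm x)%:C * onehalf R) *: ((z1 + star z1) + 'i *: (z2 + star z2)) &
   forall b, GRing.comm b x -> GRing.comm b (star x) ->
     GRing.comm b z1 /\ GRing.comm b z2].
Proof.
have [x0|x0] := eqVneq x 0.
  exists 1, 1; split; do ?[exact: unitary1].
    by rewrite x0 nrm0 rmorph0 mul0r scale0r.
  by move=> *; split; exact: commr1.
have [x' [nx' xx' _ x'C]] := normalize x0.
have [|z1 [u1 e1 c1]] := unitary_re (re_sa x'); first by rewrite -nx' nrm_re.
have [|z2 [u2 e2 c2]] := unitary_re (im_sa x'); first by rewrite -nx' nrm_im.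
exists z1, z2; split => //.
  rewrite -scalerA scalerDr scalerA [onehalf R * _]mulrC -scalerA -e1 -e2.
  by rewrite -re_im.
move=> b bx bs.
have bs' : GRing.comm b (star x').
  have : star x = (nrm x)%:C *: star x'.
    by rewrite xx' starZ; congr (_ *: _); rewrite -xx'; exact: conjc_real.
  move=> h; have := commZ (nrm x)^-1%:C bs; rewrite h scalerA -rmorphM /=.
  by rewrite mulVf ?scale1r// gt_eqF// nrm_gt0.
by have bx' := x'C _ bx; split; [apply/c1/comm_re|apply/c2/comm_im].
Qed.

(** Since every element is a combination of four unitaries, a seminorm bounded
    on unitaries is controlled by the norm. *)
Lemma seminorm_bound (N : A -> R) C :
  (forall x y, N (x + y) <= N x + N y) ->
  (forall (c : R[i]) x, N (c *: x) <= Normc.normc c * N x) ->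
  (forall z, unitary z -> N z <= C) ->
  forall x, N x <= 2 * C * nrm x.
Proof.
move=> ND NZ NU x; have [z1 [z2 [u1 u2 e _]]] := unitary_decomp x.
rewrite {1}e; apply: le_trans (NZ _ _) _.
rewrite Normc.normcM normc_onehalf normc_real ger0_norm ?nrm_ge0//.
set y := _ + _.
have : N y <= 4 * C.
  apply: le_trans (ND _ _) _.
  have h1 := ND z1 (star z1); have h2 := NZ 'i (z2 + star z2).
  have h3 := ND z2 (star z2); move: h2; rewrite normc_i mul1r.
  have := NU _ u1; have := NU _ u2.
  have := NU _ (unitary_star u1); have := NU _ (unitary_star u2); lra.
have := nrm_ge0 x; nra.
Qed.

End Unitaries.

(** * C*-subalgebras and homomorphisms *)

Section Subalgebras.
Variables (R : realType) (A : cstarType R).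
Implicit Types (x y z b : A) (S T X : set A).

Lemma cstar_subalgebraP (S : set A) :
  S 0 -> (forall c x y, S x -> S y -> S (c *: x + y)) ->
  (forall x y, S x -> S y -> S (x * y)) -> (forall x, S x -> S (star x)) ->
  (forall x, norm_closure S x -> S x) -> cstar_subalgebra S.
Proof.
move=> S0 SL SM Ss Sc; split => //; last exact/closedP.
by split=> [|c x y]; rewrite !inE//; exact: SL.
Qed.

Lemma norm_closureW (S T : set A) x :
  S `<=` T -> norm_closure S x -> norm_closure T x.
Proof. by move=> ST ax e /ax[y [Sy xy]]; exists y; split => //; exact: ST. Qed.

Lemma norm_closure_comm b x : norm_closure (GRing.comm b) x -> GRing.comm b x.
Proof.
move=> ax; apply/eqP; rewrite -subr_eq0; apply/eqP/nrm_eq0P => e e0.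
have b0 := nrm_ge0 b.
have d0 : 0 < e / (2 * nrm b + 1) by apply: divr_gt0 => //; lra.
have [y [by_ xy]] := ax _ d0.
have -> : b * x - x * b = b * (x - y) - (x - y) * b.
  by rewrite mulrBr mulrBl by_ opprB addrA subrK.
have h : e / (2 * nrm b + 1) * (2 * nrm b + 1) = e by rewrite divfK//; lra.
have := nrmB (b * (x - y)) ((x - y) * b).
have := nrmM b (x - y); have := nrmM (x - y) b.
have := nrm_ge0 (x - y); nra.
Qed.

Definition commutant (X : set A) : set A :=
  [set b | forall x, X x -> GRing.comm b x].

Lemma commutant_subalgebra (X : set A) :
  (forall x, X x -> X (star x)) -> cstar_subalgebra (commutant X).
Proof.
move=> Xs; apply: cstar_subalgebraP.
- by move=> x _; apply: commr_sym; exact: commr0.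
- move=> c x y cx cy z Xz; apply: commr_sym; apply: commrD; last exact/commr_sym/cy.
  exact/commZ/commr_sym/cx.
- move=> x y cx cy z Xz; apply: commr_sym; apply: commrM; apply/commr_sym.
    exact: cx.
  exact: cy.
- move=> x cx z /Xs/cx h; apply: (can_inj (@starK _ _)).
  by rewrite !starM !starK h.
- move=> x ax z Xz; apply/commr_sym/norm_closure_comm.
  by apply: norm_closureW ax => y cy; exact/commr_sym/cy.
Qed.

Lemma generated_sub (X S : set A) :
  cstar_subalgebra S -> X `<=` S -> cstar_generated X `<=` S.
Proof. by move=> cS XS x; apply; split. Qed.

Lemma sub_generated (X : set A) : X `<=` cstar_generated X.
Proof. by move=> x Xx S [_]; apply. Qed.

Lemma generated_subalgebra (X : set A) :
  cstar_subalgebra (cstar_generated X).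
Proof.
apply: cstar_subalgebraP.
- by move=> S [] [[+ _] _ _ _] _; rewrite inE.
- move=> c x y gx gy S [cS XS].
  have [[_ L] _ _ _] := cS; have := L c x y; rewrite !inE; apply.
    by apply: gx; split.
  by apply: gy; split.
- move=> x y gx gy S [cS XS]; have [_ M _ _] := cS.
  by apply: M; [apply: gx|apply: gy]; split.
- by move=> x gx S [cS XS]; have [_ _ T _] := cS; apply: T; apply: gx; split.
- move=> x ax S [cS XS]; have [_ _ _ /closedP] := cS; apply.
  by apply: norm_closureW ax => y; apply; split.
Qed.

End Subalgebras.

Section Homs.
Variables (R : realType) (A B : cstarType R).
Implicit Types (x y z : A) (f g : A -> B).

Lemma star_homD f : star_hom f -> {morph f : x y / x + y}.
Proof. by case=> fL _ _ _ x y; have := fL 1 x y; rewrite !scale1r. Qed.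

Lemma star_hom0 f : star_hom f -> f 0 = 0.
Proof.
by move=> /star_homD fD; have := fD 0 0; rewrite addr0 -{1}[f 0]addr0 => /addrI.
Qed.

Lemma star_homZ f : star_hom f -> forall c x, f (c *: x) = c *: f x.
Proof.
by move=> fh c x; case: (fh) => fL _ _ _; rewrite -[c *: x]addr0 fL (star_hom0 fh) addr0.
Qed.

Lemma star_homN f : star_hom f -> {morph f : x / - x}.
Proof. by move=> fh x; rewrite -scaleN1r (star_homZ fh) scaleN1r. Qed.

Lemma star_homB f : star_hom f -> {morph f : x y / x - y}.
Proof. by move=> fh x y; rewrite (star_homD fh) (star_homN fh). Qed.

Lemma star_hom_sum f (I : Type) (r : seq I) (F : I -> A) : star_hom f ->
  f (\sum_(i <- r) F i) = \sum_(i <- r) f (F i).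
Proof. by move=> fh; apply: big_morph; [exact: star_homD|exact: star_hom0]. Qed.

Lemma star_hom_unitary f z : star_hom f -> unitary z -> unitary (f z).
Proof. by case=> _ fM f1 fs [z1 z2]; split; rewrite -fs -fM ?z1 ?z2. Qed.

(** Unitaries have norm 1 and are preserved, so the bound on combinations of
    four unitaries gives continuity. *)
Lemma star_hom_bounded f x : star_hom f -> nrm (f x) <= 2 * nrm x.
Proof.
move=> fh; rewrite -{1}(mulr1 2); apply: (seminorm_bound (N := fun x => nrm (f x))).
- by move=> y z; rewrite (star_homD fh) nrmD.
- by move=> c y; rewrite (star_homZ fh) nrmZ.
- by move=> z uz; case: (star_hom_unitary fh uz) => h _; rewrite nrm_unitary.
Qed.

(** This is where continuity is needed: two homomorphisms that agree on a set
    agree on the C*-algebra that it generates. *)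
Lemma equalizer_subalgebra f g : star_hom f -> star_hom g ->
  cstar_subalgebra [set x | f x = g x].
Proof.
move=> fh gh; case: (fh) (gh) => fL fM f1 fs [gL gM g1 gs].
apply: cstar_subalgebraP => /=.
- by rewrite !star_hom0.
- by move=> c x y xe ye; rewrite fL gL xe ye.
- by move=> x y xe ye; rewrite fM gM xe ye.
- by move=> x xe; rewrite fs gs xe.
- move=> x ax; apply/eqP; rewrite -subr_eq0; apply/eqP/nrm_eq0P => e e0.
  have [|y [/= ye xy]] := ax (e / 4); first by apply: divr_gt0.
  have -> : f x - g x = f (x - y) - g (x - y).
    rewrite (star_homB fh) (star_homB gh) ye opprB addrA subrK//.
  have := star_hom_bounded (x - y) fh; have := star_hom_bounded (x - y) gh.
  have := nrmB (f (x - y)) (g (x - y)); lra.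
Qed.

End Homs.

(** * Norm closures *)

Section Closure.
Variables (R : realType) (A : cstarType R).
Implicit Types (x y z b : A) (S T : set A).

Lemma sub_norm_closure S : S `<=` norm_closure S.
Proof. by move=> x Sx e e0; exists x; rewrite subrr nrm0. Qed.

Lemma norm_closure_idem S x : norm_closure (norm_closure S) x -> norm_closure S x.
Proof.
move=> ax e e0; have [|y [ay xy]] := ax (e / 2); first by apply: divr_gt0.
have [|z [Sz yz]] := ay (e / 2); first by apply: divr_gt0.
exists z; split => //; have := nrmD (x - y) (y - z); rewrite addrA subrK; lra.
Qed.

Lemma norm_closure_lipschitz S T (f : A -> A) K x :
  (forall y, nrm (f x - f y) <= K * nrm (x - y)) ->
  (forall y, S y -> T (f y)) -> norm_closure S x -> norm_closure T (f x).
Proof.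
move=> fK fS ax e e0.
have d0 : 0 < e / (`|K| + 1) by apply: divr_gt0 => //; have := normr_ge0 K; lra.
have [y [Sy xy]] := ax _ d0; exists (f y); split; first exact: fS.
have h : e / (`|K| + 1) * (`|K| + 1) = e.
  by rewrite divfK//; have := normr_ge0 K; lra.
have := fK y; have := ler_norm K; have := nrm_ge0 (x - y).
have := normr_ge0 K; nra.
Qed.

Lemma norm_closureD S x y : (forall x y, S x -> S y -> S (x + y)) ->
  norm_closure S x -> norm_closure S y -> norm_closure S (x + y).
Proof.
move=> SD ax ay e e0.
have [|x' [Sx xx]] := ax (e / 2); first by apply: divr_gt0.
have [|y' [Sy yy]] := ay (e / 2); first by apply: divr_gt0.
exists (x' + y'); split; first exact: SD.
by rewrite opprD addrACA; apply: le_lt_trans (nrmD _ _) _; lra.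
Qed.

Lemma norm_closureZ S c x : (forall x, S x -> S (c *: x)) ->
  norm_closure S x -> norm_closure S (c *: x).
Proof.
by move=> Sc; apply: (@norm_closure_lipschitz S S (fun x => c *: x) (Normc.normc c)) => // y;
  rewrite -scalerBr nrmZ.
Qed.

Lemma norm_closureMl S T a x : (forall x, S x -> T (a * x)) ->
  norm_closure S x -> norm_closure T (a * x).
Proof.
by move=> Sc; apply: (@norm_closure_lipschitz S T (fun x => a * x) (nrm a)) => // y;
  rewrite -mulrBr nrmM.
Qed.

Lemma norm_closureMr S T a x : (forall x, S x -> T (x * a)) ->
  norm_closure S x -> norm_closure T (x * a).
Proof.
by move=> Sc; apply: (@norm_closure_lipschitz S T (fun x => x * a) (nrm a)) => // y;
  rewrite -mulrBl mulrC nrmM.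
Qed.

Lemma closure_subalgebra S : S 0 ->
  (forall x y, S x -> S y -> S (x + y)) -> (forall c x, S x -> S (c *: x)) ->
  (forall x y, S x -> S y -> S (x * y)) -> (forall x, S x -> S (star x)) ->
  cstar_subalgebra (norm_closure S).
Proof.
move=> S0 SD SZ SM Ss; apply: cstar_subalgebraP.
- exact: sub_norm_closure.
- by move=> c x y ax ay; apply: norm_closureD => //; apply: norm_closureZ => //; exact: SZ.
- move=> x y ax ay; apply: norm_closure_idem; apply: norm_closureMl ay => y' Sy.
  by apply: norm_closureMr ax => x' Sx; exact: SM.
- move=> x ax.
  by apply: (@norm_closure_lipschitz S S star 1) => // y; rewrite -starB nrm_star mul1r.
- exact: norm_closure_idem.
Qed.

End Closure.

(** * The center of a simple C*-algebra *)

Section SimpleCenter.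
Variables (R : realType) (A : cstarType R).
Hypothesis A_simple : cstar_simple A.
Implicit Types (x y z b c : A).

Let central c := forall b, GRing.comm b c.

Lemma comm_inverse k v b : k * v = 1 -> v * k = 1 -> GRing.comm b k -> GRing.comm b v.
Proof.
move=> kv vk bk; rewrite /GRing.comm -[LHS]mul1r -vk !mulrA -[v * k * b]mulrA -bk.
by rewrite mulrA -[_ * k * v]mulrA kv mulr1.
Qed.

(** The closed ideal generated by a nonzero central [c] is everything, hence
    some multiple of [c] is close to 1 and therefore invertible. *)
Lemma simple_central_invertible c : central c -> c != 0 ->
  exists v, c * v = 1 /\ v * c = 1.
Proof.
move=> cC c0; pose S := range (fun q => c * q).
have SD x y : S x -> S y -> S (x + y).
  by move=> [q _ <-] [r _ <-]; exists (q + r); rewrite ?mulrDr.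
have SZ (k : R[i]) x : S x -> S (k *: x).
  by move=> [q _ <-]; exists (k *: q); rewrite ?scalerAr.
have hI : closed_ideal (norm_closure S).
  split; last by apply/closedP => x; exact: norm_closure_idem.
  - split; rewrite ?inE.
      by apply: sub_norm_closure; exists 0; rewrite ?mulr0.
    move=> k x y; rewrite !inE => ax ay; apply: norm_closureD => //.
    by apply: norm_closureZ => //; exact: SZ.
  - move=> a x; apply: norm_closureMl => _ [q _ <-].
    by exists (a * q) => //; rewrite !mulrA cC.
  - by move=> a x; apply: norm_closureMr => _ [q _ <-]; exists (q * a); rewrite ?mulrA.
have [I0|IT] := A_simple hI.
- have : norm_closure S c by apply: sub_norm_closure; exists 1; rewrite ?mulr1.
  by rewrite I0 /= => /eqP; rewrite (negPf c0).
- have : norm_closure S 1 by rewrite IT.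
  move=> /(_ _ ltr01)[_ [[q _ <-] /neumann[v []]]].
  rewrite opprB addrCA subrr addr0 => qv vq _; exists (q * v); rewrite mulrA.
  by split => //; rewrite cC mulrA.
Qed.

(** If [1 - c^2] had an inverse [b], then [1 - d - c^2 = (1 - c^2)(1 - d b)]
    would be a square for small [d > 0], which forces [|c|^2 <= 1 - d]. *)
Lemma simple_central_sa c : central c -> star c = c -> nrm c = 1 ->
  1 - c * c = 0.
Proof.
move=> cC cs c1; apply/eqP/negPn/negP => k0.
have kC : central (1 - c * c).
  by move=> b; apply: commrB; [exact: commr1|exact: commrM].
have [b [kb bk]] := simple_central_invertible kC k0.
have bC : central b by move=> t; exact: comm_inverse kb bk (kC t).
have bs : star b = b.
  rewrite -[LHS]mulr1 -kb mulrA.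
  have -> : star b * (1 - c * c) = 1.
    by have := congr1 star kb; rewrite starM starB !star1 starM cs.
  by rewrite mul1r.
have b0 := nrm_ge0 b.
(* With this [d], [1 - d b] has a square root [k], and [y k] is a square root
   of [1 - d - c^2]. *)
pose d := (1 + nrm b)^-1.
have d0 : 0 < d by rewrite invr_gt0; lra.
have db : d * nrm b <= 1.
  by rewrite /d mulrC ler_pdivrMr ?mul1r ?lerDr// ltr_pwDl.
have [|k [kk ks kC']] := @sqrt_exists R A (d%:C *: b).
  by rewrite nrmZ normc_real gtr0_norm.
have {}ks : star k = k by apply: ks; rewrite starZ bs; congr (_ *: _); exact: conjc_real.
have {}kC' : central k by move=> t; apply: kC'; exact: commZ.
have [|y [yy ys yC]] := @sqrt_exists R A (c * c).
  by rewrite -{1}cs nrm_starM c1 expr1n.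
have {}ys : star y = y by apply: ys; rewrite starM cs.
have ws : star (y * k) = y * k by rewrite starM ks ys kC'.
have ww : (y * k) * (y * k) = (1 - c * c) - d%:C *: 1.
  by rewrite -mulrA [k * _]mulrA -[k * y]kC' -mulrA mulrA kk yy mulrBr mulr1 -scalerAr kb.
have cw : GRing.comm c (y * k) by apply: commr_sym; exact: cC.
have := nrm_starM (c + 'i *: (y * k)).
rewrite star_cartesian// cartesianM// ww addrA [c * c + _]addrC subrK.
rewrite -[in X in nrm (X - _)](scale1r 1) -scalerBl -rmorphB nrmZ normc_real nrm1 mulr1.
move=> h.
have : nrm c <= nrm (c + 'i *: (y * k)).
  rewrite -[in X in X <= _](cartesian_re c (y * k)) nrmZ normc_onehalf -star_cartesian//.
  by have := nrmD (c + 'i *: (y * k)) (star (c + 'i *: (y * k))); rewrite nrm_star; lra.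
rewrite c1; have d1 : d <= 1 by rewrite invf_le1; lra.
move: h; rewrite ger0_norm; last lra.
by move=> h; rewrite leNgt => /negP; apply; have := nrm_ge0 (c + 'i *: (y * k)); nra.
Qed.

(** A self-adjoint central [c] of norm 1 satisfies [(1 - c)(1 + c) = 0], and in
    a simple algebra one of these central factors vanishes. *)
Lemma simple_center c : central c -> exists l : R[i], c = l *: 1.
Proof.
have sa x : central x -> star x = x -> exists l : R[i], x = l *: 1.
  move=> xC xs; have [->|x0] := eqVneq x 0; first by exists 0; rewrite scale0r.
  have [x' [x'1 ex x's x'C]] := normalize x0.
  have {}x'C : central x' by move=> b; exact: x'C.
  have h := simple_central_sa x'C (x's xs) x'1.
  have [e|e] := eqVneq (1 - x') 0.
    by exists (nrm x)%:C; rewrite {1}ex; move/eqP: e; rewrite subr_eq0 => /eqP <-.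
  have eC : central (1 - x') by move=> b; apply: commrB; [exact: commr1|].
  have [v [_ vk]] := simple_central_invertible eC e.
  have : 1 + x' = v * (1 - x' * x').
    rewrite -[LHS]mul1r -{1}vk -mulrA; congr (v * _).
    by rewrite mulrDr mulr1 mulrBl mul1r addrA subrK.
  rewrite h mulr0 => /eqP; rewrite addrC addr_eq0 => /eqP e'.
  by exists (- (nrm x)%:C); rewrite {1}ex e' scalerN scaleNr.
move=> cC.
have sC : central (star c).
  by move=> b; apply: (can_inj (@starK _ _)); rewrite !starM !starK cC.
have [l hl] : exists l : R[i], re c = l *: 1.
  by apply: sa; [move=> b; exact: comm_re|exact: re_sa].
have [m hm] : exists l : R[i], im c = l *: 1.
  by apply: sa; [move=> b; exact: comm_im|exact: im_sa].
by exists (l + 'i * m); rewrite {1}(re_im c) hl hm scalerA scalerDl.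
Qed.

End SimpleCenter.

(** * The Hilbert space of a discrete group *)

Section L2.
Variables (R : realType) (G : choiceType).
Implicit Types (f g : l2 R G) (k : G).

Lemma l2norm_ge0 f : 0 <= l2norm f.
Proof. exact: sqrtr_ge0. Qed.

Lemma sqnormE f : sqnorm f = (l2norm f ^+ 2)%:E.
Proof.
have fin : (sqnorm f < +oo)%E by exact/asboolP/l2_funP.
have ge0 : (0 <= sqnorm f)%E.
  by apply: esum_ge0 => x _; rewrite lee_fin sqr_ge0.
rewrite /l2norm sqr_sqrtr ?fine_ge0// fineK// ge0_fin_numE//.
Qed.

Lemma l2norm_sum_le f (s : seq G) : uniq s ->
  \sum_(k <- s) Normc.normc (f k) ^+ 2 <= l2norm f ^+ 2.
Proof.
move=> us; rewrite -lee_fin -sqnormE -sumEFin; apply: esum_ge.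
by exists [set` s]; [split => //; exact: finite_seq|rewrite fsbig_seq].
Qed.

Lemma l2norm_sum_ge f (e : R) : 0 < e -> exists A : {fset G},
  l2norm f ^+ 2 - e < \sum_(k <- A) Normc.normc (f k) ^+ 2.
Proof.
move=> e0; have fin : sqnorm f \is a fin_num by rewrite sqnormE.
have [_ [X [finX _] <-]] := ub_ereal_sup_adherent e0 fin.
rewrite -[ereal_sup _]/(sqnorm f) sqnormE => h; exists (fset_set X).
by rewrite -lte_fin -sumEFin -fsbig_finite.
Qed.

#[local] Existing Instance totally_filter.

Lemma l2dot_xi f k : l2dot f (xi R k) = f k.
Proof.
rewrite /l2dot /summability.sum; apply: lim_near_cst; first exact: norm_hausdorff.
exists [fset k]%fset => // A /= kA.
have {}kA : k \in A by apply: (fsubsetP kA); rewrite inE.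
rewrite /partial_sum -(big_seq_fsetE _ A xpredT (fun h => f h * (xi R k h)^*)).
rewrite (big_fsetD1 k)//= eqxx rmorph1 mulr1 big_seq big1 ?addr0// => h.
by rewrite !inE => /andP[/negPf -> _]; rewrite rmorph0 mulr0.
Qed.

Lemma mulcJ (c : R[i]) : c * Num.conj c = (Normc.normc c ^+ 2)%:C.
Proof.
case: c => a b; apply/eqP; rewrite eq_complex /= sqr_sqrtr ?addr_ge0 ?sqr_ge0//.
by apply/andP; split; apply/eqP; ring.
Qed.

Lemma l2dot_self f : l2dot f f = (l2norm f ^+ 2)%:C.
Proof.
rewrite /l2dot /summability.sum; apply: cvg_lim; first exact: norm_hausdorff.
apply/cvgrPdist_lt => e e0.
have e0' : 0 < complex.Re e by move: e0; rewrite ltcE /= => /andP[].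
have [A0 hA] := l2norm_sum_ge f e0'.
exists A0 => // A /= A0A.
rewrite /partial_sum -(big_seq_fsetE _ A xpredT (fun h => f h * (f h)^*)) /=.
under eq_bigr do rewrite mulcJ.
rewrite -rmorph_sum -rmorphB /=.
have -> : e = (complex.Re e)%:C by rewrite RRe_real// gtr0_real.
have le1 := l2norm_sum_le f (fset_uniq A).
rewrite normc_def /= expr0n addr0 sqrtr_sqr ltcR ger0_norm ?subr_ge0//.
rewrite ltrBlDl -ltrBlDr; apply: (lt_le_trans hA).
rewrite (big_fsetID _ (mem A0) A) /=.
have -> : [fset x in A | x \in A0]%fset = A0.
  apply/fsetP => x; rewrite !inE; apply/andP/idP => [[]//|xA0].
  by split => //; exact: (fsubsetP A0A).
by rewrite lerDl; apply: sumr_ge0 => k _; exact: sqr_ge0.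
Qed.

(** Cauchy--Schwarz against the indicator function of a finite set of points. *)
Lemma l2_sum_points f (s : seq G) : uniq s ->
  Normc.normc (\sum_(k <- s) f k) <= Num.sqrt (size s)%:R * l2norm f.
Proof.
move=> us.
have tri : Normc.normc (\sum_(k <- s) f k) <= \sum_(k <- s) Normc.normc (f k).
  elim: s {us} => [|k s IH]; first by rewrite !big_nil Normc.normc0.
  by rewrite !big_cons; apply: le_trans (le_normcD _ _) _; rewrite lerD2l.
apply: le_trans tri _.
have cs (r : seq G) : (\sum_(k <- r) Normc.normc (f k)) ^+ 2 <=
    (size r)%:R * \sum_(k <- r) Normc.normc (f k) ^+ 2.
  elim: r => [|k r IH]; first by rewrite !big_nil expr0n mul0r.
  rewrite !big_cons /= -natr1.
  set x := Normc.normc _; set S := \sum_(_ <- _) _; set T := \sum_(_ <- _) _.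
  set n : R := (size r)%:R.
  have n0 : 0 <= n by [].
  rewrite -/S -/T -/n in IH.
  have T0 : 0 <= T by apply: sumr_ge0 => ? _; exact: sqr_ge0.
  have [n00|n00] := eqVneq n 0.
    have : S = 0
      by apply/eqP; rewrite -sqrf_eq0 eq_le sqr_ge0 andbT; rewrite n00 mul0r in IH.
    by move=> ->; rewrite n00; nra.
  have npos : 0 < n by rewrite lt_def n00.
  rewrite -subr_ge0 -(pmulr_rge0 _ npos).
  have -> : n * ((n + 1) * (x ^+ 2 + T) - (x + S) ^+ 2) =
     (n * x - S) ^+ 2 + (n + 1) * (n * T - S ^+ 2) by ring.
  by rewrite addr_ge0 ?sqr_ge0// mulr_ge0 ?subr_ge0// addr_ge0.
have S0 : 0 <= \sum_(k <- s) Normc.normc (f k).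
  by apply: sumr_ge0 => k _; exact: normc_ge0.
rewrite -(@ler_pXn2r _ 2)// ?nnegrE ?mulr_ge0 ?sqrtr_ge0 ?l2norm_ge0//.
apply: le_trans (cs s) _; rewrite exprMn sqr_sqrtr// ler_wpM2l//.
exact: l2norm_sum_le.
Qed.

Lemma l2_point f k : Normc.normc (f k) <= l2norm f.
Proof.
have := @l2_sum_points f [:: k] isT.
by rewrite big_seq1 /= sqrtr1 mul1r.
Qed.

End L2.

Section Representation.
Variables (R : realType) (G : groupType) (A : cstarType R).
Variable (pi : A -> l2 R G -> l2 R G).
Hypothesis rep : l2_representation pi.
Implicit Types (a b z : A) (f : l2 R G).

Lemma rep_unitary z f : unitary z -> l2norm (pi z f) = l2norm f.
Proof.
move=> [zz _].
have : l2dot (pi z f) (pi z f) = l2dot f f.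
  by rewrite -(rep_star rep) -(rep_mul rep) zz (rep_one rep).
rewrite !l2dot_self => /complexI /eqP; rewrite eqrXn2 ?l2norm_ge0//.
by move=> /eqP.
Qed.

Lemma repD a b f : pi (a + b) f = pi a f + pi b f.
Proof. by have := rep_linear rep 1 a b f; rewrite !scale1r. Qed.

Lemma rep0 f : pi 0 f = 0.
Proof. by apply: (addrI (pi 0 f)); rewrite -repD !addr0. Qed.

Lemma repZ c a f : pi (c *: a) f = c *: pi a f.
Proof. by have := rep_linear rep c a 0 f; rewrite !addr0 rep0 addr0. Qed.

Lemma rep_sum (I : Type) (r : seq I) (F : I -> A) f :
  pi (\sum_(i <- r) F i) f = \sum_(i <- r) pi (F i) f.
Proof.
by apply: (big_morph (fun a => pi a f)); [move=> a b; exact: repD|exact: rep0].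
Qed.

(** Matrix coefficients are seminorms bounded by [l2norm f] on unitaries, which
    act isometrically. *)
Lemma rep_coord_bound a f k :
  Normc.normc (pi a f k) <= 2 * l2norm f * nrm a.
Proof.
apply: (seminorm_bound (N := fun a => Normc.normc (pi a f k))).
- by move=> x y; rewrite repD /=; exact: le_normcD.
- by move=> c x; rewrite repZ /=; rewrite -Normc.normcM.
- by move=> z uz; apply: le_trans (l2_point _ _) _; rewrite rep_unitary.
Qed.

End Representation.

(** * Monomials and averaging *)

Section Span.
Variables (R : realType) (A : cstarType R).
Implicit Types (X : set A) (x y : A).

Inductive lin_span X : A -> Prop :=
| lin_span0 : lin_span X 0
| lin_span_cons c x y : X x -> lin_span X y -> lin_span X (c *: x + y).

Lemma lin_span_gen X x : X x -> lin_span X x.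
Proof.
move=> Xx; rewrite -[x]addr0 -[x]scale1r.
by apply: lin_span_cons => //; exact: lin_span0.
Qed.

Lemma lin_spanD X x y : lin_span X x -> lin_span X y -> lin_span X (x + y).
Proof.
move=> sx sy; elim: sx => [|c z t Xz _ IH]; first by rewrite add0r.
by rewrite -addrA; exact: lin_span_cons.
Qed.

Lemma lin_spanZ X c x : lin_span X x -> lin_span X (c *: x).
Proof.
elim=> [|d z t Xz _ IH]; first by rewrite scaler0; exact: lin_span0.
by rewrite scalerDr scalerA; exact: lin_span_cons.
Qed.

Lemma lin_span_star X x : (forall x, X x -> X (star x)) ->
  lin_span X x -> lin_span X (star x).
Proof.
move=> Xs; elim=> [|d z t Xz _ IH]; first by rewrite star0; exact: lin_span0.
by rewrite starD starZ; apply: lin_span_cons => //; exact: Xs.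
Qed.

Lemma lin_spanM X x y : (forall x y, X x -> X y -> lin_span X (x * y)) ->
  lin_span X x -> lin_span X y -> lin_span X (x * y).
Proof.
move=> XM sx sy; elim: sx => [|c z t Xz _ IH].
  by rewrite mul0r; exact: lin_span0.
rewrite mulrDl; apply: lin_spanD => //; rewrite -scalerAl; apply: lin_spanZ.
elim: sy => [|d z' t' Xz' _ IH']; first by rewrite mulr0; exact: lin_span0.
rewrite mulrDr; apply: lin_spanD => //; rewrite -scalerAr; apply: lin_spanZ; exact: XM.
Qed.

Lemma generated_norm_closure_span X :
  (forall x, X x -> X (star x)) -> (forall x y, X x -> X y -> lin_span X (x * y)) ->
  cstar_generated X `<=` norm_closure (lin_span X).
Proof.
move=> Xs XM; apply: generated_sub; last first.
  by move=> x Xx; exact/sub_norm_closure/lin_span_gen.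
apply: closure_subalgebra.
- exact: lin_span0.
- exact: lin_spanD.
- by move=> c x; exact: lin_spanZ.
- by move=> x y; exact: lin_spanM.
- by move=> x; exact: lin_span_star.
Qed.

End Span.

Section Dynamics.
Variables (R : realType) (G : groupType) (P : monoidType).
Variables (theta : P -> G -> G) (Q : cstarType R) (u : G -> Q) (s : P -> Q).
Hypothesis sys : ads theta.
Hypothesis Gcomm : forall g h : G, commute g h.
Hypothesis fam : bq_family theta u s.
Implicit Types (g h k : G) (p q : P) (x y z : Q).

Lemma theta1 p : theta p 1%g = 1%g.
Proof. by apply: (mulgI (theta p 1%g)); rewrite -(ads_morph sys) !mulg1. Qed.

Lemma thetaV p g : theta p g^-1%g = (theta p g)^-1%g.
Proof.
by apply: (mulgI (theta p g)); rewrite -(ads_morph sys) !mulgV theta1.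
Qed.

Lemma u_mul g h : u (g * h)%g = u g * u h.
Proof. by case: (bq_unitary fam). Qed.

Lemma u_one : u 1%g = 1.
Proof. by case: (bq_unitary fam). Qed.

Lemma u_unitary g : unitary (u g).
Proof. by case: (bq_unitary fam). Qed.

Lemma u_star g : star (u g) = u g^-1%g.
Proof.
by rewrite -[LHS]mulr1 -u_one -(mulgV g) u_mul mulrA (u_unitary g).1 mul1r.
Qed.

Lemma u_comm g h : u g * u h = u h * u g.
Proof. by rewrite -!u_mul Gcomm. Qed.

Lemma s_one : s 1%g = 1.
Proof. by case: (bq_isometry fam). Qed.

Lemma s_mul p q : s (p * q)%g = s p * s q.
Proof. by case: (bq_isometry fam). Qed.

Lemma s_u p g : s p * u g = u (theta p g) * s p.
Proof. exact: bq_covariant fam _ _. Qed.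

Lemma sstar_u p g : star (s p) * u (theta p g) = u g * star (s p).
Proof.
have := congr1 star (s_u p g^-1%g).
by rewrite !starM !u_star thetaV !invgK.
Qed.

Definition monomial g p q h := u g * s p * star (s q) * u h.

Definition monomials : set Q :=
  [set x | exists g p q h, x = monomial g p q h].

Lemma monomial_star g p q h : star (monomial g p q h) = monomial h^-1%g q p g^-1%g.
Proof. by rewrite /monomial !starM starK !u_star !mulrA. Qed.

(** Relation (II) rewrites the inner factor [s_q^* u_g s_r] of a product of two
    monomials with its starred isometry on the right. *)
Lemma monomialM x y : monomials x -> monomials y -> lin_span monomials (x * y).
Proof.
move=> [a [p [q [b ->]]]] [c [r [t [d ->]]]].
have -> : monomial a p q b * monomial c r t d =
    u a * s p * (star (s q) * u (b * c)%g * s r) * star (s t) * u d.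
  by rewrite /monomial u_mul !mulrA.
have [[g1 [g2 [p' [q' fac]]]]|nofac] :=
  pselect (exists g1 g2 p' q', factors theta q r (b * c)%g g1 g2 p' q'); last first.
  by rewrite (bq_product0 fam nofac) mulr0 !mul0r; exact: lin_span0.
rewrite (bq_product fam fac); apply: lin_span_gen.
exists (a * theta p g1)%g, (p * p')%g, (t * q')%g, (theta t g2 * d)%g.
rewrite /monomial !u_mul !s_mul starM !mulrA -[u a * s p * u g1]mulrA s_u !mulrA.
by congr (_ * u d); rewrite -[LHS]mulrA -sstar_u !mulrA.
Qed.

Lemma monomials_dense : cstar_generated (range u `|` range s) = [set: Q] ->
  forall x, norm_closure (lin_span monomials) x.
Proof.
move=> gen x; apply: generated_norm_closure_span.
- by move=> _ [a [p [q [b ->]]]]; rewrite monomial_star; exists b^-1%g, q, p, a^-1%g.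
- exact: monomialM.
suff: [set: Q] `<=` cstar_generated monomials by apply.
rewrite -gen; apply: generated_sub; first exact: generated_subalgebra.
move=> _ [[g _ <-]|[p _ <-]]; apply: sub_generated.
  by exists g, 1%g, 1%g, 1%g; rewrite /monomial u_one s_one star1 !mulr1.
by exists 1%g, p, 1%g, 1%g; rewrite /monomial u_one s_one star1 !mulr1 mul1r.
Qed.

(** By covariance [u_(theta_q(k))^*] passes through [s_q^*] as [u_k^*] and then
    through [s_p] as [u_(theta_p(k))^*]. *)
Lemma conj_monomial a p q b k :
  u (theta q k) * monomial a p q b * star (u (theta q k)) =
  u (Phi theta q p k) * monomial a p q b.
Proof.
rewrite u_star -thetaV /monomial -!mulrA [u b * _]u_comm.
rewrite [star (s q) * (_ * _)]mulrA sstar_u -mulrA [s p * (u _ * _)]mulrA s_u.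
by rewrite /Phi u_mul -!mulrA; congr (_ * _); rewrite !mulrA [u a * _]u_comm.
Qed.

(** Up to the factor [size t], an average of conjugates; the elements of [t] may
    repeat, so that composing averages amounts to multiplying lists. *)
Definition conj_sum (t : seq G) x := \sum_(g <- t) u g * x * star (u g).

Lemma conj_sumD t x y : conj_sum t (x + y) = conj_sum t x + conj_sum t y.
Proof. by rewrite -big_split; apply: eq_bigr => g _; rewrite mulrDr mulrDl. Qed.

Lemma conj_sumZ t c x : conj_sum t (c *: x) = c *: conj_sum t x.
Proof. by rewrite scaler_sumr; apply: eq_bigr => g _; rewrite -scalerAr -scalerAl. Qed.

Lemma conj_sum_allpairs t t' x :
  conj_sum [seq (g * h)%g | g <- t, h <- t'] x = conj_sum t (conj_sum t' x).
Proof.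
rewrite /conj_sum big_allpairs_dep; apply: eq_bigr => g _.
rewrite mulr_sumr mulr_suml; apply: eq_bigr => h _.
by rewrite u_mul starM !mulrA.
Qed.

Lemma conj_sumC t t' x : conj_sum t (conj_sum t' x) = conj_sum t' (conj_sum t x).
Proof.
rewrite -!conj_sum_allpairs /conj_sum !big_allpairs_dep exchange_big /=.
by apply: eq_bigr => g _; apply: eq_bigr => h _; rewrite (Gcomm g).
Qed.

Lemma nrm_conj_sum t x : nrm (conj_sum t x) <= (size t)%:R * nrm x.
Proof.
elim: t => [|g t IH]; first by rewrite /conj_sum big_nil nrm0 mul0r.
rewrite /conj_sum big_cons -/(conj_sum t x) /= -natr1 mulrDl mul1r addrC.
apply: le_trans (nrmD _ _) _; apply: lerD => //.
have [h1 h2] := u_unitary g.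
have e1 := nrm_unitary h1.
apply: le_trans (nrmM _ _) _; rewrite nrm_star e1 mulr1.
by apply: le_trans (nrmM _ _) _; rewrite e1 mul1r.
Qed.

Lemma conj_sum_comm t x : commutant (range u) x -> conj_sum t x = (size t)%:R *: x.
Proof.
move=> xC; rewrite /conj_sum (eq_bigr (fun=> x)); last first.
  by move=> g _; rewrite -[u g * x]xC// -mulrA (u_unitary g).2 mulr1.
by rewrite big_const_seq count_predT iter_addr_0 scaler_nat.
Qed.

Lemma commutant_u_star x : commutant (range u) x -> commutant (range u) (star x).
Proof.
move=> xC; have rs : forall y, range u y -> range u (star y).
  by move=> _ [g _ <-]; rewrite u_star; exists g^-1%g.
by have [_ _ h _] := commutant_subalgebra rs; exact: h.
Qed.

End Dynamics.

(** * Rigidity of the relative commutant *)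

Section Transversal.
Variables (G : groupType) (P : monoidType) (theta : P -> G -> G).
Hypothesis sys : ads theta.

Lemma transversal_exists p : finite_index theta p ->
  exists t, coset_transversal theta p t.
Proof.
move=> fin.
pose X := fset_set (left_cosets theta p).
have coset_at C g : left_cosets theta p C -> C g ->
    C = [set (g * theta p h)%g | h in [set: G]].
  move=> [a _ <-] [b _ <-]; apply/seteqP; split=> _ [h _ <-].
    exists (b^-1 * h)%g => //.
    by rewrite (ads_morph sys) (thetaV sys) mulgA mulgK.
  by exists (b * h)%g => //; rewrite (ads_morph sys) mulgA.
have xgetP C : left_cosets theta p C -> C (xget 1%g C).
  move=> [a _ <-]; apply: (@xgetPex _ 1%g [set (a * theta p h)%g | h in [set: G]]).
  by exists (a * theta p 1)%g, 1%g.
exists [seq xget 1%g C | C <- X]; split.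
  rewrite map_inj_in_uniq ?fset_uniq// => C D.
  rewrite !in_fset_set// !inE => cC cD e.
  have := coset_at _ _ cC (xgetP _ cC); rewrite e => ->.
  by apply/esym/coset_at => //; exact: xgetP.
move=> C cC; exists (xget 1%g C); split.
  split; last exact: xgetP.
  by apply/mapP; exists C => //; rewrite in_fset_set// inE.
move=> _ [/mapP[D + ->] CD]; rewrite in_fset_set// inE => cD.
suff -> : C = D by [].
by rewrite (coset_at C _ cC CD); apply/esym/coset_at => //; exact: xgetP.
Qed.

End Transversal.

Lemma infinite_order_inj (G : groupType) (g : G) : infinite_order g ->
  injective (fun n => (g ^+ n)%g).
Proof.
move=> inf m n /= e; wlog mn : m n e / (m <= n)%N.
  by move=> W; case: (leqP m n) => [|/ltnW] h; [exact: W|apply/esym/W].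
apply/eqP; rewrite eqn_leq mn /= leqNgt; apply/negP => lt.
apply: (inf (n - m)%N); first by rewrite subn_gt0.
by rewrite expgnFr// e mulgV.
Qed.

Section RelativeCommutant.
Variables (R : realType) (G : groupType) (P : monoidType).
Variables (theta : P -> G -> G) (Q : cstarType R) (u : G -> Q) (s : P -> Q).
Variable (pi : Q -> l2 R G -> l2 R G).
Hypothesis sys : ads theta.
Hypothesis Gcomm : forall g h : G, commute g h.
Hypothesis fin : forall p, finite_index theta p.
Hypothesis fam : bq_family theta u s.
Hypothesis can : canonical_rep theta u s pi.
Hypothesis separate : forall p q : P, p <> q -> exists g : G,
  infinite_order g /\ set_inj (cyclic_subgroup g) (Phi theta p q).
Variable psi : Q -> Q.
Hypothesis psi_hom : star_hom psi.
Hypothesis psi_u : forall g, psi (u g) = u g.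
Implicit Types (g h k : G) (p q : P) (x y z : Q) (f : l2 R G).

Let rep := proj1 can.

Lemma pi_u_xi g h : pi (u g) (xi R h) = xi R (g * h)%g.
Proof. by rewrite -[u g]mulr1 -(s_one fam) (proj2 can) (ads_act1 sys). Qed.

Lemma pi_u g f k : pi (u g) f k = f (g^-1 * k)%g.
Proof.
rewrite -l2dot_xi -[g in LHS]invgK -(u_star fam) (rep_star rep).
by rewrite pi_u_xi l2dot_xi.
Qed.

Lemma l2_sumE (I : Type) (r : seq I) (F : I -> l2 R G) k :
  (\sum_(i <- r) F i) k = \sum_(i <- r) F i k.
Proof. by apply: (big_morph (fun f : l2 R G => f k)). Qed.

Lemma l2_zeroE k : (0 : l2 R G) k = 0.
Proof. by []. Qed.

Definition defect x := x - psi x.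

Lemma defectD x y : defect (x + y) = defect x + defect y.
Proof. by rewrite /defect (star_homD psi_hom) opprD addrACA. Qed.

Lemma defectZ c x : defect (c *: x) = c *: defect x.
Proof. by rewrite /defect (star_homZ psi_hom) scalerBr. Qed.

Lemma nrm_defect x : nrm (defect x) <= 3 * nrm x.
Proof.
have := nrmB x (psi x); have := star_hom_bounded x psi_hom.
rewrite /defect; lra.
Qed.

Lemma defect_bimodule g h x : defect (u g * x * u h) = u g * defect x * u h.
Proof.
have [_ psiM _ _] := psi_hom.
by rewrite /defect !psiM !psi_u mulrBr mulrBl.
Qed.

Lemma conj_sum_defect t x : conj_sum u t (defect x) = defect (conj_sum u t x).
Proof.
rewrite /conj_sum [in RHS]/defect (star_hom_sum _ _ psi_hom) -sumrB.
by apply: eq_bigr => g _; rewrite (u_star fam) -defect_bimodule.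
Qed.

(** After one averaging, all further averages have matrix coefficients at most
    [e |f|].  Allowing a further average over [t] makes the property stable
    under sums: the averages found for two summands commute, so each of them
    serves as the further average of the other. *)
Definition avg_negligible x := forall e : R, 0 < e -> exists t0 : seq G,
  (0 < size t0)%N /\ forall t f k,
  Normc.normc (pi (conj_sum u t (conj_sum u t0 (defect x))) f k) <=
    e * (size t)%:R * (size t0)%:R * l2norm f.

Lemma avg_negligible_lin c x y :
  avg_negligible x -> avg_negligible y -> avg_negligible (c *: x + y).
Proof.
move=> nx ny e e0; set C := Normc.normc c.
have C0 : 0 <= C by exact: normc_ge0.
have d0 : 0 < e / (C + 1) by apply: divr_gt0 => //; lra.
have hd : e / (C + 1) * (C + 1) = e by rewrite divfK//; lra.
set d := e / (C + 1) in d0 hd.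
have [t1 [t1_gt0 h1]] := nx _ d0; have [t2 [t2_gt0 h2]] := ny _ d0.
exists [seq (g * h)%g | g <- t1, h <- t2]; split.
  by rewrite size_allpairs muln_gt0 t1_gt0.
move=> t f k; rewrite (conj_sum_allpairs fam) defectD defectZ.
rewrite 3!conj_sumD 3!conj_sumZ.
rewrite (repD rep) (repZ rep) /=; apply: le_trans (le_normcD _ _) _.
rewrite [Normc.normc (c *: _)]Normc.normcM -/C size_allpairs natrM.
rewrite [conj_sum u t1 (conj_sum u t2 (defect x))](conj_sumC Gcomm fam).
rewrite -!(conj_sum_allpairs fam).
have := h1 [seq (g * h)%g | g <- t, h <- t2] f k.
have := h2 [seq (g * h)%g | g <- t, h <- t1] f k.
rewrite !(conj_sum_allpairs fam) !size_allpairs !natrM.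
set a := Normc.normc _; set b := Normc.normc _.
set n := (size t)%:R; set n1 := (size t1)%:R; set n2 := (size t2)%:R.
set l := l2norm f => ha hb.
apply: le_trans (lerD (ler_wpM2l C0 hb) ha) _.
by rewrite -hd le_eqVlt; apply/orP; left; apply/eqP; ring.
Qed.

Lemma avg_negligible0 : avg_negligible 0.
Proof.
move=> e e0; exists [:: 1%g]; split => // t f k.
have -> : defect 0 = 0 by rewrite /defect (star_hom0 psi_hom) subrr.
have c0 t' : conj_sum u t' 0 = 0.
  by rewrite /conj_sum big1// => g _; rewrite mulr0 mul0r.
rewrite !c0 (rep0 rep) l2_zeroE Normc.normc0.
by rewrite !mulr_ge0 ?l2norm_ge0// ltW.
Qed.

(** Averaging over a transversal of [G / theta_p(G)] turns [u_g s_p s_p^* u_h]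
    into a multiple of [u_(gh)]. *)
Lemma avg_negligible_diagonal a p b : avg_negligible (monomial u s a p p b).
Proof.
move=> e e0; have [t0 ht0] := transversal_exists sys (fin p).
have sum1 := bq_sum fam (fin p) ht0.
exists t0; split.
  rewrite lt0n; apply: contra_eqN sum1 => /nilP ->.
  by rewrite big_nil eq_sym oner_eq0.
move=> t f k; rewrite conj_sum_defect.
have -> : conj_sum u t0 (monomial u s a p p b) = u a * 1 * u b.
  rewrite -sum1 mulr_sumr mulr_suml; apply: eq_bigr => g _.
  rewrite /monomial (u_star fam) !mulrA (u_comm Gcomm fam g a) -!mulrA.
  by rewrite (u_comm Gcomm fam b).
rewrite defect_bimodule {1}/defect; have [_ _ -> _] := psi_hom.
rewrite subrr mulr0 mul0r.
have -> : conj_sum u t 0 = 0.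
  by rewrite /conj_sum big1// => g _; rewrite mulr0 mul0r.
by rewrite (rep0 rep) l2_zeroE Normc.normc0 !mulr_ge0 ?l2norm_ge0// ltW.
Qed.

(** If [p <> q], conjugating [u_g s_p s_q^* u_h] by the first [N] powers of a
    suitable element multiplies it with [N] distinct unitaries [u_v]; by
    Cauchy--Schwarz their sum has matrix coefficients of size [sqrt N]. *)
Lemma avg_negligible_off_diagonal a p q b : p <> q ->
  avg_negligible (monomial u s a p q b).
Proof.
move=> pq e e0; set m := monomial u s a p q b.
have [g0 [g0_inf g0_inj]] := separate (fun e => pq (esym e)).
have [_ [M hM]] := rep_bounded rep (defect m).
(* The bound at stake is [sqrt N * |M| <= e * N], that is [(|M| / e)^2 <= N]. *)
pose N := (Num.truncn ((`|M| / e) ^+ 2)).+1.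
have MN : Num.sqrt N%:R * `|M| <= e * N%:R :> R.
  have h : `|M| / e <= Num.sqrt N%:R.
    rewrite -[leLHS]ger0_norm ?divr_ge0 ?(ltW e0)// -sqrtr_sqr ler_wsqrtr//.
    exact/ltW/truncnS_gt.
  move: h; rewrite ler_pdivrMr// => h.
  apply: le_trans (ler_wpM2l (sqrtr_ge0 _) h) _.
  by rewrite mulrA -expr2 sqr_sqrtr// mulrC.
pose t0 := [seq theta q (g0 ^+ n)%g | n <- iota 0 N].
exists t0; split; first by rewrite size_map size_iota.
move=> t f k; rewrite size_map size_iota.
pose v n := Phi theta q p (g0 ^+ n)%g.
have v_inj : injective v.
  move=> i j vij; apply: (infinite_order_inj g0_inf); apply: g0_inj vij.
    by rewrite inE; exists i; left.
  by rewrite inE; exists j; left.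
have -> : conj_sum u t0 (defect m) = \sum_(n <- iota 0 N) u (v n) * defect m.
  rewrite conj_sum_defect /conj_sum big_map.
  rewrite [LHS]/defect (star_hom_sum _ _ psi_hom) -sumrB; apply: eq_bigr => n _.
  rewrite -[LHS]/(defect _) (conj_monomial sys Gcomm fam) -/m -/(v n).
  by rewrite -[u _ * m]mulr1 -(u_one fam) defect_bimodule (u_one fam) mulr1.
rewrite /conj_sum (rep_sum rep) l2_sumE.
have bound g : Normc.normc (pi (u g * (\sum_(n <- iota 0 N) u (v n) * defect m)
    * star (u g)) f k) <= e * N%:R * l2norm f.
  set f' := pi (defect m) (pi (star (u g)) f).
  have -> : pi (u g * (\sum_(n <- iota 0 N) u (v n) * defect m) * star (u g)) f k
     = \sum_(i <- [seq ((v n)^-1 * (g^-1 * k))%g | n <- iota 0 N]) f' i.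
    rewrite !(rep_mul rep) pi_u (rep_sum rep) l2_sumE big_map.
    by apply: eq_bigr => n _; rewrite (rep_mul rep) pi_u.
  apply: le_trans (l2_sum_points _ _) _.
    rewrite map_inj_in_uniq ?iota_uniq// => i j _ _ /mulIg/invg_inj; exact: v_inj.
  rewrite size_map size_iota.
  have h := hM (pi (star (u g)) f).
  rewrite (rep_unitary rep _ (unitary_star (u_unitary fam g))) in h.
  have {}h : l2norm f' <= `|M| * l2norm f.
    by apply: le_trans h _; rewrite ler_wpM2r ?l2norm_ge0// ler_norm.
  apply: le_trans (ler_wpM2l (sqrtr_ge0 _) h) _.
  by rewrite mulrA ler_wpM2r ?l2norm_ge0.
elim: t => [|g t IH]; first by rewrite big_nil Normc.normc0 /= mulr0 !mul0r.
rewrite big_cons /= -natr1; apply: le_trans (le_normcD _ _) _.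
apply: le_trans (lerD (bound g) IH) _.
by rewrite le_eqVlt; apply/orP; left; apply/eqP; ring.
Qed.

Lemma avg_negligible_span x : lin_span (monomials u s) x -> avg_negligible x.
Proof.
elim=> [|c y z [a [p [q [b ->]]]] _ nz]; first exact: avg_negligible0.
apply: avg_negligible_lin => //.
have [<-|pq] := pselect (p = q); first exact: avg_negligible_diagonal.
exact: avg_negligible_off_diagonal.
Qed.

(** An element commuting with the [u_g] equals all its averages, and those of
    its defect can be made small in every matrix coefficient. *)
Lemma relative_commutant_fixed d : injective pi ->
  cstar_generated (range u `|` range s) = [set: Q] ->
  commutant (range u) d -> psi d = d.
Proof.
move=> pi_inj gen dC.
suff d0 : defect d = 0 by apply/eqP; rewrite eq_sym -subr_eq0; apply/eqP.
apply: pi_inj; apply/funext => f; rewrite (rep0 rep); apply/val_inj/funext => k /=.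
have defC : commutant (range u) (defect d).
  move=> _ [g _ <-]; have [_ psiM _ _] := psi_hom.
  have dug : d * u g = u g * d by apply: dC; exists g.
  rewrite /GRing.comm /defect mulrBl mulrBr dug; congr (_ - _).
  by rewrite -(psi_u g) -!psiM dug.
have small e : 0 < e -> Normc.normc (pi (defect d) f k) <= e * l2norm f.
  move=> e0.
  have [|y [sy dy]] := monomials_dense sys fam gen d (e := e / 12).
    by apply: divr_gt0.
  have [|t0 [t0_gt0 h]] := avg_negligible_span sy (e := e / 2); first exact: divr_gt0.
  have := h [:: 1%g] f k.
  have -> : conj_sum u [:: 1%g] (conj_sum u t0 (defect y)) = conj_sum u t0 (defect y).
    by rewrite {1}/conj_sum big_seq1 (u_one fam) star1 mul1r mulr1.
  have n0 : 0 < (size t0)%:R :> R by rewrite ltr0n.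
  have h2 := nrm_conj_sum fam t0 (defect (d - y)).
  have h3 := nrm_defect (d - y).
  have h4 := rep_coord_bound rep (conj_sum u t0 (defect (d - y))) f k.
  have split_d : (size t0)%:R *: pi (defect d) f =
      pi (conj_sum u t0 (defect y)) f + pi (conj_sum u t0 (defect (d - y))) f.
    rewrite -(repD rep) -conj_sumD -defectD addrC subrK.
    by rewrite (conj_sum_comm fam) ?(repZ rep).
  have := congr1 (fun f : l2 R G => Normc.normc (f k)) split_d.
  rewrite /= [Normc.normc (_ *: _)]Normc.normcM.
  have -> : Normc.normc ((size t0)%:R : R[i]) = (size t0)%:R.
    by rewrite -(rmorph_nat (real_complex R)) normc_real ger0_norm.
  move=> E h1.
  have tri := le_normcD (pi (conj_sum u t0 (defect y)) f k)
                        (pi (conj_sum u t0 (defect (d - y))) f k).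
  rewrite -E /= mulr1 in tri h1.
  rewrite -(ler_pM2l n0); apply: le_trans tri _.
  apply: le_trans (lerD h1 h4) _.
  have L0 := l2norm_ge0 f.
  have h5 : nrm (conj_sum u t0 (defect (d - y))) <= (size t0)%:R * (e / 4).
    by apply: le_trans h2 _; rewrite ler_pM2l//; lra.
  apply: le_trans (lerD (lexx _) (ler_wpM2l _ h5)) _; first by rewrite mulr_ge0.
  by rewrite le_eqVlt; apply/orP; left; apply/eqP; field.
apply: Normc.eq0_normc; apply/le_anti; rewrite normc_ge0 andbT.
apply/ler_addgt0Pr => e e0; rewrite add0r.
have L0 := l2norm_ge0 f.
have d0 : 0 < e / (l2norm f + 1) by apply: divr_gt0 => //; lra.
apply: le_trans (small _ d0) _.
rewrite -mulrA ler_piMr ?(ltW e0)// mulrC ler_pdivrMr ?mul1r; lra.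
Qed.

End RelativeCommutant.

(** * Inner automorphisms *)

Section InnerAutomorphisms.
Variables (R : realType) (A : cstarType R).
Implicit Types (x y z b : A).

Lemma inner_hom z : unitary z -> star_hom (fun x => z * x * star z).
Proof.
move=> [zz1 zz2]; split=> [c x y|x y||x].
- by rewrite mulrDr mulrDl -scalerAr -scalerAl.
- by rewrite !mulrA -[_ * star z * z]mulrA zz1 mulr1.
- by rewrite mulr1 zz2.
- by rewrite !starM starK mulrA.
Qed.

Lemma inner_bij z : unitary z -> bijective (fun x => z * x * star z).
Proof.
move=> [zz1 zz2]; exists (fun x => star z * x * z) => x /=.
  by rewrite !mulrA zz1 mul1r -mulrA zz1 mulr1.
by rewrite !mulrA zz2 mul1r -mulrA zz2 mulr1.
Qed.

Definition inner z (zu : unitary z) : starAut A :=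
  StarAut (inner_hom zu) (inner_bij zu).

Lemma inner_fixed z x : unitary z -> z * x * star z = x -> GRing.comm x z.
Proof. by move=> [zz1 _] e; rewrite /GRing.comm -{1}e -mulrA zz1 mulr1. Qed.

Lemma commutes_inner z x : unitary z -> GRing.comm x z -> z * x * star z = x.
Proof. by move=> [_ zz2] e; rewrite -e -mulrA zz2 mulr1. Qed.

Lemma comm_star_unitary z x : unitary z -> GRing.comm x z -> GRing.comm x (star z).
Proof.
move=> [zz1 zz2] xz.
by rewrite /GRing.comm -[LHS]mul1r -zz1 -!mulrA [z * _]mulrA -xz -mulrA zz2 mulr1.
Qed.

(** [b = 1 + c w] is normal and [b^*] is invertible by the Neumann series, so
    [b b^*^-1] is unitary. *)
Lemma moebius_unitary w (c : R[i]) : unitary w -> Normc.normc c < 1 ->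
  exists v, let b := 1 + c *: w in
    [/\ star b * v = 1, v * star b = 1, unitary (b * v) &
     forall x, GRing.comm x w -> GRing.comm x v].
Proof.
move=> wu c1; set b := 1 + c *: w.
pose a := - (Num.conj c *: star w).
have sb : star b = 1 - a by rewrite opprK starD star1 starZ.
have nc (d : R[i]) : Normc.normc (Num.conj d) = Normc.normc d.
  by case: d => p q /=; rewrite sqrrN.
have [|v [h1 h2 vC]] := @neumann R A a.
  rewrite nrmN nrmZ nrm_star nc; case: (wu) => /nrm_unitary -> _.
  by rewrite mulr1.
rewrite -sb in h1 h2; exists v => /=.
have wC x : GRing.comm x w -> GRing.comm x v.
  by move=> xw; apply: vC; apply/commrN/commZ; exact: comm_star_unitary.
have vw : GRing.comm w v by exact: wC.
have sv1 : star v * b = 1 by have := congr1 star h1; rewrite starM starK star1.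
have sv2 : b * star v = 1 by have := congr1 star h2; rewrite starM starK star1.
have svC : GRing.comm (star v) v.
  apply: wC; apply: commr_sym; apply: comm_inverse sv2 sv1 _.
  by apply: commrD; [exact: commr1|exact: commZ].
split => //; split; rewrite starM.
- have bb : GRing.comm b (star b).
    rewrite sb; apply: commr_sym; apply: commrD; first exact: commr1.
    apply/commZ/commr_sym/commrB; first exact: commr1.
    by apply/commrN/commZ; rewrite /GRing.comm wu.1 wu.2.
  by rewrite -mulrA [star b * _]mulrA -bb -[b * _ * v]mulrA h1 mulr1.
- by rewrite -mulrA [v * _]mulrA -svC -!mulrA h2 mulr1.
Qed.

End InnerAutomorphisms.

Lemma scale_eq_lin (K : pzRingType) (V : lmodType K) (x y z : V)
    (l a b c a' b' c' : K) :
  a *: x + b *: y - c *: z = l *: (a' *: x + b' *: y - c' *: z) ->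
  (a - l * a') *: x + (b - l * b') *: y + (l * c' - c) *: z = 0.
Proof.
move=> /eqP; rewrite -subr_eq0 => /eqP <-.
rewrite !scalerBl scalerBr scalerDr !scalerA opprB [X in X + _ = _]addrACA -opprD.
by rewrite [LHS]addrACA [RHS]addrACA; congr (_ + _); rewrite addrC.
Qed.

(** * The automorphisms fixing the group algebra *)

Section Main.
Variables (R : realType) (G : groupType) (P : monoidType).
Variables (theta : P -> G -> G) (Q : cstarType R) (u : G -> Q) (s : P -> Q).
Variable (pi : Q -> l2 R G -> l2 R G).
Hypothesis sys : ads theta.
Hypothesis Gcomm : forall g h : G, commute g h.
Hypothesis fin : forall p, finite_index theta p.
Hypothesis bq : boundary_quotient theta u s.
Hypothesis can : canonical_rep theta u s pi.
Hypothesis pi_inj : injective pi.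
Hypothesis separate : forall p q : P, p <> q -> exists g : G,
  infinite_order g /\ set_inj (cyclic_subgroup g) (Phi theta p q).
Implicit Types (g h k : G) (p q : P) (x y z : Q) (f : l2 R G).
Implicit Types phi psi : starAut Q.

Let fam := bq_rel bq.
Let rep := proj1 can.
Let B := cstar_generated (range u).
Let H := fixing_aut B.

Lemma fixing_generators phi : (forall g, phi (u g) = u g) -> H phi.
Proof.
move=> hu x; apply: (@generated_sub R Q (range u) [set x | phi x = x]).
  exact: equalizer_subalgebra (aut_hom phi) (star_hom_id Q).
by move=> _ [g _ <-]; exact: hu.
Qed.

Lemma fixingE phi g : H phi -> phi (u g) = u g.
Proof. by apply; apply: sub_generated; exists g. Qed.

Lemma fixing_commutant phi d : H phi -> commutant (range u) d -> phi d = d.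
Proof.
move=> Hphi; apply: (relative_commutant_fixed sys Gcomm fin fam can separate
  (aut_hom phi) _ pi_inj (bq_gen bq)).
by move=> g; exact: fixingE.
Qed.

Lemma fixing_inner z (zu : unitary z) : commutant (range u) z -> H (inner zu).
Proof.
move=> zC; apply: fixing_generators => g /=; apply: commutes_inner => //.
by apply: commr_sym; apply: zC; exists g.
Qed.

(** Unitaries of the relative commutant act by inner automorphisms fixing the
    [u_g], which therefore fix the relative commutant. *)
Lemma commutant_abelian d e :
  commutant (range u) d -> commutant (range u) e -> GRing.comm d e.
Proof.
move=> dC eC; have [z1 [z2 [u_one u2 ed cC]]] := unitary_decomp d.
have zC g : GRing.comm (u g) z1 /\ GRing.comm (u g) z2.
  by apply: cC; apply: commr_sym; [apply: dC|apply: (commutant_u_star fam dC)]; exists g.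
have comm_e z : unitary z -> (forall g, GRing.comm (u g) z) ->
    GRing.comm e (z + star z).
  move=> zu zc; have ez : GRing.comm e z.
    apply: inner_fixed => //; apply: (fixing_commutant (fixing_inner zu _)) => //.
    by move=> _ [g _ <-]; exact/commr_sym/zc.
  by apply: commrD => //; exact: comm_star_unitary.
apply: commr_sym; rewrite ed; apply/commZ/commrD.
  by apply: comm_e => // g; case: (zC g).
by apply/commZ/comm_e => // g; case: (zC g).
Qed.

(** Relation (III) gives [phi(s_p)] as the sum of the [u_k s_p (s_p^* u_k^*
    phi(s_p))], and the factors in parentheses commute with the [u_g] because
    [phi(s_p)] and [s_p] satisfy the same covariance relation. *)
Lemma isometry_expansion p : exists t : seq G, forall phi, H phi ->
  exists d : G -> Q, (forall k, commutant (range u) (d k)) /\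
    phi (s p) = \sum_(k <- t) u k * s p * d k.
Proof.
have [t ht] := transversal_exists sys (fin p).
exists t => phi Hphi; exists (fun k => star (s p) * star (u k) * phi (s p)); split.
  move=> k _ [g _ <-]; have [_ phiM _ _] := aut_hom phi.
  rewrite /GRing.comm -{1}(fixingE g Hphi) -mulrA -phiM (s_u fam) phiM fixingE//.
  rewrite !mulrA; congr (_ * _).
  by rewrite (u_star fam) -mulrA (u_comm Gcomm fam) mulrA (sstar_u sys fam).
rewrite -[LHS]mul1r -(bq_sum fam (fin p) ht) mulr_suml.
by apply: eq_bigr => k _; rewrite !mulrA.
Qed.

(** Two expansions as in [isometry_expansion] are exchanged by commuting the
    [u_k] and the coefficients, none of which is moved by the automorphisms. *)
Lemma fixing_abelian : abelian_subgroup H.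
Proof.
split.
  split; first by rewrite inE.
  move=> phi psi; rewrite !inE => Hphi Hpsi x Bx /=.
  have e : aut_inv psi x = x.
    rewrite -{1}(Hpsi x Bx).
    exact: (congr1 (fun f : starAut Q => f x) (aut_mulVg psi)).
  by rewrite [X in phi X]e Hphi.
move=> phi psi Hphi Hpsi; apply: starAut_ext => x /=.
have : [set: Q] x by []; rewrite -(bq_gen bq); move: x.
apply: (@generated_sub R Q _ [set x | phi (psi x) = psi (phi x)]).
  exact: equalizer_subalgebra (star_hom_comp (aut_hom phi) (aut_hom psi))
           (star_hom_comp (aut_hom psi) (aut_hom phi)).
move=> _ [[g _ <-]|[p _ <-]] /=; first by rewrite !fixingE// !fixingE.
have [t ht] := isometry_expansion p.
have [d [dC ed]] := ht _ Hphi; have [e [eC ee]] := ht _ Hpsi.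
have [_ phiM _ _] := aut_hom phi; have [_ psiM _ _] := aut_hom psi.
rewrite {1}ee (star_hom_sum _ _ (aut_hom phi)).
rewrite [in RHS]ed (star_hom_sum _ _ (aut_hom psi)).
under eq_bigr => k _ do
  rewrite !phiM fixingE// (fixing_commutant Hphi (eC k)) ed mulr_sumr mulr_suml.
under [in RHS]eq_bigr => k _ do
  rewrite !psiM fixingE// (fixing_commutant Hpsi (dC k)) ee mulr_sumr mulr_suml.
rewrite exchange_big /=; apply: eq_bigr => j _; apply: eq_bigr => k _.
rewrite -!mulrA (commutant_abelian (dC j) (eC k)) !mulrA.
by rewrite (u_comm Gcomm fam).
Qed.

(** Evaluation at [xi 1] separates the [u_h]; if [g^2 = 1], the last two terms
    contribute to the same coefficient. *)
Lemma coefficients_eq0 g (a b c : R[i]) : g <> 1%g ->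
  a *: 1 + b *: u g + c *: u g^-1%g = 0 ->
  a = 0 /\ (if g^-1%g == g then b + c = 0 else b = 0).
Proof.
move=> g1 e.
have ev k : a * (k == 1%g)%:R + b * (k == g)%:R + c * (k == g^-1%g)%:R = 0.
  have := congr1 (fun x => pi x (xi R 1%g) k) e.
  rewrite !(repD rep) !(repZ rep) (rep_one rep) (rep0 rep).
  by rewrite !(pi_u_xi sys fam can) !mulg1.
have := ev 1%g; have := ev g; rewrite eqxx.
have -> : (g == 1%g) = false by apply/eqP.
have -> : (1%g == g) = false by apply/eqP => /esym.
have -> : (1%g == g^-1%g) = false by rewrite eq_sym invg_eq1; apply/eqP.
rewrite (eq_sym g) !mulr0 !mulr1 !addr0 !add0r eqxx mulr1 => h2 h1; split => //.
by move: h2; case: eqP; rewrite ?mulr1 ?mulr0 ?addr0.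
Qed.

Hypothesis simple : cstar_simple Q.

Section Centralizer.
Variable phi : starAut Q.
Hypothesis phi_comm : forall psi, H psi -> commute phi psi.

(** Conjugations by [z] and by [phi(z)] coincide, so [z^* phi(z)] is central. *)
Lemma centralizer_unitary z : unitary z -> commutant (range u) z ->
  exists l : R[i], phi z = l *: z.
Proof.
move=> zu zC; have [_ phiM _ phis] := aut_hom phi.
have conj_phi x : phi z * phi x * star (phi z) = z * phi x * star z.
  have := phi_comm (fixing_inner zu zC) => /(congr1 (fun f : starAut Q => f x)) /=.
  by rewrite !phiM phis.
have [phiV _ phiK] := aut_bij phi.
have [pz1 _] := star_hom_unitary (aut_hom phi) zu; have [zz1 zz2] := zu.
have [l hl] : exists l : R[i], star z * phi z = l *: 1.
  apply: simple_center => // y; have := conj_phi (phiV y); rewrite phiK => e.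
  have : phi z * y = z * y * star z * phi z.
    by rewrite -e -mulrA pz1 mulr1.
  by move=> e'; rewrite /GRing.comm -[RHS]mulrA e' !mulrA zz1 mul1r.
by exists l; rewrite -[LHS]mul1r -zz2 -mulrA hl -scalerAr mulr1.
Qed.

(** With [phi(u_g) = chi u_g], the equation [phi(z) = l z] for the Moebius
    unitary [z] becomes an identity between combinations of [1], [u_g] and
    [u_g^*], whose coefficients give two equations for [l] and [chi]. *)
Lemma centralizer_u g : phi (u g) = u g.
Proof.
have uC' h : commutant (range u) (u h).
  by move=> _ [k _ <-]; exact: u_comm Gcomm fam _ _.
have [chi hchi] := centralizer_unitary (u_unitary fam g) (uC' g).
have [->|g1] := pselect (g = 1%g).
  by rewrite (u_one fam); case: (aut_hom phi).
have uu := u_unitary fam g.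
have scalar_inj (a b : R[i]) : a *: (1 : Q) = b *: 1 -> a = b.
  move=> /eqP; rewrite -subr_eq0 -scalerBl scaler_eq0 oner_eq0 orbF subr_eq0.
  by move=> /eqP.
have chi_unit : chi * Num.conj chi = 1.
  apply: scalar_inj; have [_ h] := star_hom_unitary (aut_hom phi) uu.
  by move: h; rewrite hchi starZ -scalerAl -scalerAr scalerA uu.2 scale1r.
have hchi' : phi (star (u g)) = Num.conj chi *: star (u g).
  by have [_ _ _ phis] := aut_hom phi; rewrite phis hchi starZ.
(* A real [c] would not detect [chi = -1] when [g] has order 2. *)
pose c : R[i] := 'i * onehalf R.
have cJ : Num.conj c = - c by rewrite rmorphM /= conj_i conj_onehalf mulNr.
have c2 : c * c = - 4^-1.
  rewrite /c mulrACA mulii mulN1r.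
  have -> : onehalf R = 2^-1 by rewrite /onehalf fmorphV rmorph_nat.
  by field.
have [|v] := @moebius_unitary R Q (u g) c uu.
  by rewrite Normc.normcM normc_i mul1r normc_onehalf invf_lt1// (ltr_nat R 1 2).
set b := 1 + c *: u g => /= -[bv vb zu vC].
have zC : commutant (range u) (b * v).
  move=> _ [k _ <-]; apply: commr_sym; apply: commrM; last first.
    by apply: vC; exact: (u_comm Gcomm fam).
  by apply: commrD; [exact: commr1|apply/commZ; exact: (u_comm Gcomm fam)].
have [l hl] := centralizer_unitary zu zC.
have [_ phiM phi1 phis] := aut_hom phi.
have phib : phi b = 1 + (c * chi) *: u g.
  by rewrite (star_homD (aut_hom phi)) phi1 (star_homZ (aut_hom phi)) hchi scalerA.
have sb : star b = 1 - c *: star (u g) by rewrite starD star1 starZ cJ scaleNr.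
have phisb : phi (star b) = 1 - (c * Num.conj chi) *: star (u g).
  by rewrite phis phib starD star1 starZ rmorphM /= cJ mulNr scaleNr.
have key : phi b * star b = l *: (b * phi (star b)).
  have e : phi b = l *: (b * v) * phi (star b).
    by rewrite -hl phiM -mulrA -phiM vb phi1 mulr1.
  have cv : GRing.comm (phi (star b)) v.
    apply: vC; rewrite phisb; apply: commr_sym; apply: commrB; first exact: commr1.
    by apply: commZ; rewrite /GRing.comm uu.1 uu.2.
  by rewrite {1}e -!scalerAl -[b * v * _]mulrA -cv -!mulrA vb mulr1.
have expand (m n : R[i]) : (1 + (c * m) *: u g) * (1 - (c * n) *: star (u g)) =
   (1 + m * n / 4) *: 1 + (c * m) *: u g - (c * n) *: u g^-1%g.
  rewrite mulrDl mul1r mulrBr mulr1 -scalerAl -scalerAr scalerA uu.2 (u_star fam).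
  have -> : c * m * (c * n) = - (m * n / 4).
    by rewrite mulrACA c2 mulNr mulrC.
  rewrite scaleNr opprK scalerDl scale1r -!addrA; congr (_ + _).
  by rewrite [LHS]addrC -addrA addrCA.
have key' : (1 + (c * chi) *: u g) * (1 - (c * 1) *: star (u g)) =
    l *: ((1 + (c * 1) *: u g) * (1 - (c * Num.conj chi) *: star (u g))).
  by rewrite mulr1 -phib -phisb -sb.
move: key'; rewrite !expand => /scale_eq_lin/(coefficients_eq0 g1).
rewrite !mulr1 !mul1r => -[e0].
have c_neq0 : c != 0.
  by apply: contra_eq_neq c2 => ->; rewrite mul0r eq_sym oppr_eq0 invr_eq0 pnatr_eq0.
have chi1 : chi = 1 -> phi (u g) = u g by rewrite hchi => ->; rewrite scale1r.
(* If [g^2 <> 1], the coefficient at [g] gives [l = chi]; if [g^2 = 1], then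
   [chi = 1] or [chi = -1], the coefficient at 1 gives [l = 1], and the one at
   [g] gives [2 c (chi - 1) = 0]. *)
case: eqP => [gg|_] e1; apply: chi1; last first.
  have lE : l = chi.
    apply: (mulfI c_neq0); apply/eqP; rewrite -subr_eq0 -oppr_eq0 opprB.
    by rewrite [c * l]mulrC e1.
  move: e0; rewrite lE mulrDr mulr1 mulrA chi_unit => e0.
  have /eqP : (3 / 4) * (1 - chi) = 0 by rewrite -e0; field.
  have n34 : (3 / 4 : R[i]) != 0 by rewrite mulf_neq0// ?invr_eq0 pnatr_eq0.
  by rewrite mulf_eq0 (negPf n34) subr_eq0 => /eqP.
have chi2 : chi * chi = 1.
  apply: scalar_inj; have := chi_unit.
  have : phi (u g) * phi (u g) = 1.
    by have [_ <- <- _] := aut_hom phi; rewrite -(u_mul fam) -{2}gg mulgV (u_one fam).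
  rewrite hchi -scalerAl -scalerAr scalerA -(u_mul fam) -{2}gg mulgV.
  by rewrite (u_one fam) scale1r.
have chiJ : Num.conj chi = chi.
  by rewrite -[LHS]mul1r -chi2 -mulrA chi_unit mulr1.
rewrite chiJ in e0 e1.
have chi4 : 1 + chi / 4 != 0.
  apply/eqP => h; have : chi * chi - 1 = (1 + chi / 4) * (4 * chi - 16) + 15 by field.
  by rewrite h mul0r add0r chi2 subrr => /esym/eqP; rewrite pnatr_eq0.
have l1 : l = 1.
  apply: (mulIf chi4); apply/eqP; rewrite mul1r eq_sym -subr_eq0.
  by rewrite e0.
have : (2 * c) * (chi - 1) = 0 by rewrite -e1 l1; ring.
move/eqP; rewrite mulf_eq0 mulf_eq0 (negPf c_neq0) pnatr_eq0 /= subr_eq0.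
by move/eqP.
Qed.

End Centralizer.

Lemma fixing_maximal_abelian : maximal_abelian H.
Proof.
split; first exact: fixing_abelian.
move=> [K [[_ Kab] [HK KH]]]; apply: KH => phi Kphi.
apply: fixing_generators => g; apply: centralizer_u => psi Hpsi.
by apply: Kab => //; exact: HK.
Qed.

End Main.

Theorem corollary6p6 (R : realType) (G : groupType) (P : monoidType)
    (theta : P -> G -> G) (Q : cstarType R) (u : G -> Q) (s : P -> Q)
    (pi : Q -> l2 R G -> l2 R G) :
  ads theta ->
  (forall g h : G, commute g h) ->
  (forall p q : P, commute p q) ->
  (forall p : P, finite_index theta p) ->
  boundary_quotient theta u s ->
  canonical_rep theta u s pi ->
  injective pi ->
  (forall p q : P, p <> q -> exists g : G,
     infinite_order g /\ set_inj (cyclic_subgroup g) (Phi theta p q)) ->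
  cstar_simple Q ->
  maximal_abelian (fixing_aut (cstar_generated (range u))).
Proof.
move=> sys Gcomm _ fin bq can pi_inj separate simple.
exact: fixing_maximal_abelian sys Gcomm fin bq can pi_inj separate simple.
Qed.
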